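(* Let $G$ be a group, let $\mathcal A=\prod_{\lambda\in\Lambda}\mathcal A_\lambda$ be a product of commutative indecomposable unital rings, let $\alpha$ be a unital partial action of $G$ on $\mathcal A$ and let $(\beta,\mathcal B)$ be an enveloping action of $(\alpha,\mathcal A)$. Then, for every integer $n\ge0$, the partial cohomology group $H^n(G,\mathcal A)$ is isomorphic to the classical (global) cohomology group $H^n(G,\mathcal U(\mathcal M(\mathcal B)))$.
   Context: Rings are associative, not necessarily unital; $\mathcal U(\cdot)$ denotes the group of invertible elements. A unital ring is indecomposable if it is nonzero and its only central idempotents are $0$ and $1$; the product may be infinite. A partial action $\alpha$ of a group $G$ (identity $1$) on a ring $\mathcal A$ is a collection of two-sided ideals $\mathcal D_g\subseteq\mathcal A$ and ring isomorphisms $\alpha_g:\mathcal D_{g^{-1}}\to\mathcal D_g$ ($g\in G$) such that (i) $\mathcal D_1=\mathcal A$, $\alpha_1=\mathrm{id}$; (ii) $\alpha_g(\mathcal D_{g^{-1}}\cap\mathcal D_h)=\mathcal D_g\cap\mathcal D_{gh}$; (iii) $\alpha_g(\alpha_h(a))=\alpha_{gh}(a)$ for $a\in\mathcal D_{h^{-1}}\cap\mathcal D_{h^{-1}g^{-1}}$. It is unital if every $\mathcal D_g=1_g\mathcal A$ for an idempotent $1_g$ central in $\mathcal A$ (so $\mathcal A$ has identity $1_{\mathcal A}=1_1$). Partial cohomology ($\mathcal A$ commutative, $\alpha$ unital). For $n\ge1$ put $1_{(x_1,\dots,x_n)}=1_{x_1}1_{x_1x_2}\cdots1_{x_1\cdots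 x_n}$ and $\mathcal D_{(x_1,\dots,x_n)}=1_{(x_1,\dots,x_n)}\mathcal A$. $C^n(G,\mathcal A)$ is the abelian group (pointwise multiplication) of functions $f:G^n\to\mathcal A$ with $f(x_1,\dots,x_n)$ invertible in the ideal $\mathcal D_{(x_1,\dots,x_n)}$ (whose identity is $1_{(x_1,\dots,x_n)}$); inverses are taken in these ideals. $C^0(G,\mathcal A)=\mathcal U(\mathcal A)$. For $n\ge 1$, $(\delta^nf)(x_1,\dots,x_{n+1})=\alpha_{x_1}(1_{x_1^{-1}}f(x_2,\dots,x_{n+1}))\prod_{i=1}^nf(x_1,\dots,x_ix_{i+1},\dots,x_{n+1})^{(-1)^i}\cdot f(x_1,\dots,x_n)^{(-1)^{n+1}}$, and $(\delta^0a)(x)=\alpha_x(1_{x^{-1}}a)a^{-1}$. $H^n(G,\mathcal A)=\ker\delta^n/\operatorname{im}\delta^{n-1}$ for $n\ge1$ and $H^0(G,\mathcal A)=\ker\delta^0$. An enveloping action of $\alpha$ is a (global) action $\beta$ of $G$ by automorphisms on a ring $\mathcal B$ together with an injective ring homomorphism $\varphi:\mathcal A\to\mathcal B$ such that $\varphi(\mathcal A)$ is a two-sided ideal of $\mathcal B$, $\varphi(\mathcal D_g)=\varphi(\mathcal A)\cap\beta_g(\varphi(\mathcal A))$, $\varphi(\alpha_g(a))=\beta_g(\varphi(a))$ for $a\in\mathcal D_{g^{-1}}$, and $\mathcal B=\sum_{g\in G}\beta_g(\varphi(\mathcal A))$. The multiplier ring $\mathcal M(\mathcal B)$ is the ring of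 pairs $u=(R,L)$ of a left $\mathcal B$-module endomorphism $R$ (written on the right) and a right $\mathcal B$-module endomorphism $L$ of $\mathcal B$ with $(aR)b=a(Lb)$ for all $a,b\in\mathcal B$. For commutative $\mathcal A$, both $\mathcal B$ and $\mathcal M(\mathcal B)$ are commutative. $G$ acts on $\mathcal M(\mathcal B)$ by $\beta^*_g(u)=\beta_gu\beta_g^{-1}=(\beta_g^{-1}R\beta_g,\beta_gL\beta_g^{-1})$ for $u=(R,L)$, and $\mathcal U(\mathcal M(\mathcal B))$ is a $G$-module via $\beta^*$. *)

(* Defs.v *)
From HB Require Import structures.
From mathcomp Require Import all_boot all_order all_algebra all_classical.

Set Implicit Arguments.
Unset Strict Implicit.
Unset Printing Implicit Defensive.

Import GRing.Theory.
Local Open Scope classical_set_scope.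
Local Open Scope ring_scope.

(* Associative rings, not necessarily unital. *)
HB.mixin Record Zmodule_isRng V of GRing.Zmodule V := {
  rmul : V -> V -> V;
  rmulA : associative rmul;
  rmulDl : left_distributive rmul +%R;
  rmulDr : right_distributive rmul +%R;
}.
#[short(type="rngType")]
HB.structure Definition Rng := { V of Zmodule_isRng V & GRing.Zmodule V }.

Notation "x ** y" := (rmul x y) (at level 40, left associativity) : ring_scope.

(* The multiplication is a parameter, so that the definition covers both unital
   rings and rngs. *)
Definition two_sided_ideal (V : zmodType) (mul : V -> V -> V) (I : set V) :=
  [/\ I 0, forall x y, I x -> I y -> I (x - y)
    & forall a x, I x -> I (mul a x) /\ I (mul x a)].

Definition indecomposable (R : pzRingType) :=
  (1 : R) != 0 /\
  forall e : R, e * e = e -> (forall a, e * a = a * e) -> e = 0 \/ e = 1.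

Definition prod_ring (Lambda : Type) (A : Lambda -> comPzRingType) : Type :=
  forall l, A l.

Section ProdRing.
Variables (Lambda : Type) (A : Lambda -> comPzRingType).
Local Notation P := (prod_ring A).

HB.instance Definition _ := gen_eqMixin P.
HB.instance Definition _ := gen_choiceMixin P.

Let zero : P := fun l => 0.
Let one : P := fun l => 1.
Let add (a b : P) : P := fun l => a l + b l.
Let opp (a : P) : P := fun l => - a l.
Let mul (a b : P) : P := fun l => a l * b l.

Let addA : associative add.
Proof. by move=> a b c; apply: functional_extensionality_dep => l; apply: addrA. Qed.
Let addC : commutative add.
Proof. by move=> a b; apply: functional_extensionality_dep => l; apply: addrC. Qed.
Let add0 : left_id zero add.
Proof. by move=> a; apply: functional_extensionality_dep => l; apply: add0r. Qed.
Let addN : left_inverse zero opp add.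
Proof. by move=> a; apply: functional_extensionality_dep => l; apply: addNr. Qed.

HB.instance Definition _ := GRing.isZmodule.Build P addA addC add0 addN.

Let mulA : associative mul.
Proof. by move=> a b c; apply: functional_extensionality_dep => l; apply: mulrA. Qed.
Let mulC : commutative mul.
Proof. by move=> a b; apply: functional_extensionality_dep => l; apply: mulrC. Qed.
Let mul1 : left_id one mul.
Proof. by move=> a; apply: functional_extensionality_dep => l; apply: mul1r. Qed.
Let mulD : left_distributive mul +%R.
Proof. by move=> a b c; apply: functional_extensionality_dep => l; apply: mulrDl. Qed.

HB.instance Definition _ := GRing.Zmodule_isComPzRing.Build P mulA mulC mul1 mulD.

End ProdRing.

Definition ring_iso_on (A : pzRingType) (D D' : set A) (f : A -> A) :=
  [/\ set_bij D D' f,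
      forall a b, D a -> D b -> f (a + b) = f a + f b
    & forall a b, D a -> D b -> f (a * b) = f a * f b].

(* pa_act g is a total function, but only its restriction to pa_dom g^-1 is
   meaningful. *)
Record partial_action (G : groupType) (A : pzRingType) := PartialAction {
  pa_dom : G -> set A;
  pa_act : G -> A -> A;
  pa_ideal : forall g, two_sided_ideal *%R (pa_dom g);
  pa_iso : forall g, ring_iso_on (pa_dom g^-1%g) (pa_dom g) (pa_act g);
  pa_dom1 : pa_dom 1%g = setT;
  pa_act1 : forall a, pa_act 1%g a = a;
  pa_actI : forall g h, pa_act g @` (pa_dom g^-1%g `&` pa_dom h)
                        = pa_dom g `&` pa_dom (g * h)%g;
  pa_actM : forall g h a, pa_dom h^-1%g a -> pa_dom (h^-1 * g^-1)%g a ->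
    pa_act g (pa_act h a) = pa_act (g * h)%g a
}.

(* pa_one g is the idempotent 1_g; it is determined by the ideal. *)
Record unital_partial_action (G : groupType) (A : pzRingType) :=
    UnitalPartialAction {
  upa_pa :> partial_action G A;
  pa_one : G -> A;
  pa_one_idem : forall g, pa_one g * pa_one g = pa_one g;
  pa_one_central : forall g a, pa_one g * a = a * pa_one g;
  pa_domE : forall g, pa_dom upa_pa g = range ( *%R (pa_one g))
}.

Record ring_action (G : groupType) (B : rngType) := RingAction {
  ra_act :> G -> B -> B;
  ra_actD : forall g a b, ra_act g (a + b) = ra_act g a + ra_act g b;
  ra_actM : forall g a b, ra_act g (a ** b) = ra_act g a ** ra_act g b;
  ra_act1 : forall b, ra_act 1%g b = b;
  ra_actG : forall g h b, ra_act (g * h)%g b = ra_act g (ra_act h b)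
}.

Record enveloping_action (G : groupType) (A : pzRingType)
    (alpha : partial_action G A) (B : rngType) (beta : ring_action G B)
    (phi : A -> B) : Prop := EnvelopingAction {
  env_D : forall a b, phi (a + b) = phi a + phi b;
  env_M : forall a b, phi (a * b) = phi a ** phi b;
  env_inj : injective phi;
  env_ideal : two_sided_ideal rmul (range phi);
  env_dom : forall g, phi @` pa_dom alpha g = range phi `&` (beta g @` range phi);
  env_act : forall g a, pa_dom alpha g^-1%g a ->
    phi (pa_act alpha g a) = beta g (phi a);
  env_sum : forall b, exists s : seq (G * A),
    b = \sum_(p <- s) beta p.1 (phi p.2)
}.

Definition is_multiplier (B : rngType) (u : (B -> B) * (B -> B)) :=
  let: (R, L) := u in
  [/\ forall a b, R (a + b) = R a + R b,
      forall a b, R (a ** b) = a ** R b,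
      forall a b, L (a + b) = L a + L b,
      forall a b, L (a ** b) = L a ** b
    & forall a b, R a ** b = a ** L b].

Record multiplier (B : rngType) := Multiplier {
  mval : (B -> B) * (B -> B);
  mvalP : `[< is_multiplier mval >]
}.

HB.instance Definition _ (B : rngType) := [isSub for @mval B].
HB.instance Definition _ (B : rngType) := [Choice of multiplier B by <:].

Definition mR (B : rngType) (u : multiplier B) : B -> B := (mval u).1.
Definition mL (B : rngType) (u : multiplier B) : B -> B := (mval u).2.

Section RngTheory.
Variable B : rngType.
Implicit Types a b : B.

Lemma rmul0r a : 0 ** a = 0.
Proof. by apply: (addrI (0 ** a)); rewrite -rmulDl !addr0. Qed.
Lemma rmulr0 a : a ** 0 = 0.
Proof. by apply: (addrI (a ** 0)); rewrite -rmulDr !addr0. Qed.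
Lemma rmulNr a b : (- a) ** b = - (a ** b).
Proof. by apply/eqP; rewrite -addr_eq0 -rmulDl addNr rmul0r. Qed.
Lemma rmulrN a b : a ** (- b) = - (a ** b).
Proof. by apply/eqP; rewrite -addr_eq0 -rmulDr addNr rmulr0. Qed.
Lemma rmul_sumr I (r : seq I) a (F : I -> B) :
  a ** (\sum_(i <- r) F i) = \sum_(i <- r) a ** F i.
Proof. exact: (big_morph _ (rmulDr a) (rmulr0 a)). Qed.
Lemma rmul_suml I (r : seq I) a (F : I -> B) :
  (\sum_(i <- r) F i) ** a = \sum_(i <- r) F i ** a.
Proof. by apply: (big_morph (rmul^~ a)); [move=> x y; apply: rmulDl | apply: rmul0r]. Qed.
End RngTheory.

Section MultiplierRing.
Variable B : rngType.
Local Notation M := (multiplier B).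
Implicit Types u v w : M.

Lemma multP u : is_multiplier (mR u, mL u).
Proof. by case: u => -[R L] H; apply/asboolP. Qed.

Lemma mRD u a b : mR u (a + b) = mR u a + mR u b. Proof. by case: (multP u). Qed.
Lemma mRM u a b : mR u (a ** b) = a ** mR u b. Proof. by case: (multP u). Qed.
Lemma mLD u a b : mL u (a + b) = mL u a + mL u b. Proof. by case: (multP u). Qed.
Lemma mLM u a b : mL u (a ** b) = mL u a ** b. Proof. by case: (multP u). Qed.
Lemma mRL u a b : mR u a ** b = a ** mL u b. Proof. by case: (multP u). Qed.

Lemma mult_eq u v : mR u =1 mR v -> mL u =1 mL v -> u = v.
Proof.
move=> eR eL; apply: val_inj; rewrite /= [mval u]surjective_pairing.
rewrite [mval v]surjective_pairing; congr pair; exact/funext.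
Qed.

Let zeroP : `[< is_multiplier (fun=> 0 : B, fun=> 0 : B) >].
Proof. by apply/asboolP; split=> *; rewrite ?addr0 ?rmul0r ?rmulr0. Qed.
Let oneP : `[< is_multiplier (@id B, @id B) >].
Proof. by apply/asboolP; split. Qed.
Let addP u v :
  `[< is_multiplier (fun b => mR u b + mR v b, fun b => mL u b + mL v b) >].
Proof.
apply/asboolP; split=> a b; rewrite ?mRD ?mLD ?mRM ?mLM ?rmulDl ?rmulDr ?mRL //.
  by rewrite addrACA.
by rewrite addrACA.
Qed.
Let oppP u : `[< is_multiplier (fun b => - mR u b, fun b => - mL u b) >].
Proof.
apply/asboolP; split=> a b; rewrite ?mRD ?mLD ?mRM ?mLM ?opprD //.
- by rewrite rmulrN.
- by rewrite rmulNr.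
- by rewrite rmulNr rmulrN mRL.
Qed.
Let mulP u v :
  `[< is_multiplier (fun b => mR v (mR u b), fun b => mL u (mL v b)) >].
Proof. by apply/asboolP; split=> a b; rewrite ?mRD ?mLD ?mRM ?mLM ?mRL. Qed.

Definition mult_zero : M := Multiplier zeroP.
Definition mult_one : M := Multiplier oneP.
Definition mult_add u v : M := Multiplier (addP u v).
Definition mult_opp u : M := Multiplier (oppP u).
(* As R is written on the right, the first component of a product applies the R
   of the left factor first. *)
Definition mult_mul u v : M := Multiplier (mulP u v).

Let addA : associative mult_add.
Proof. by move=> u v w; apply: mult_eq => b; apply: addrA. Qed.
Let addC : commutative mult_add.
Proof. by move=> u v; apply: mult_eq => b; apply: addrC. Qed.
Let add0 : left_id mult_zero mult_add.
Proof. by move=> u; apply: mult_eq => b; apply: add0r. Qed.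
Let addN : left_inverse mult_zero mult_opp mult_add.
Proof. by move=> u; apply: mult_eq => b; apply: addNr. Qed.

HB.instance Definition _ := GRing.isZmodule.Build M addA addC add0 addN.

Let mulA : associative mult_mul.
Proof. by move=> u v w; apply: mult_eq. Qed.
Let mul1 : left_id mult_one mult_mul.
Proof. by move=> u; apply: mult_eq. Qed.
Let mul1' : right_id mult_one mult_mul.
Proof. by move=> u; apply: mult_eq. Qed.
Let mulDl : left_distributive mult_mul +%R.
Proof. by move=> u v w; apply: mult_eq => b //; apply: mRD. Qed.
Let mulDr : right_distributive mult_mul +%R.
Proof. by move=> u v w; apply: mult_eq => b //; apply: mLD. Qed.

HB.instance Definition _ := GRing.Zmodule_isPzRing.Build M mulA mul1 mul1' mulDl mulDr.

Lemma mR_mul u v b : mR (u * v) b = mR v (mR u b). Proof. by []. Qed.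
Lemma mL_mul u v b : mL (u * v) b = mL u (mL v b). Proof. by []. Qed.

Variables (G : groupType) (beta : ring_action G B).

Lemma ra_actK g : cancel (beta g) (beta g^-1%g).
Proof. by move=> b; rewrite -ra_actG mulVg ra_act1. Qed.
Lemma ra_actKV g : cancel (beta g^-1%g) (beta g).
Proof. by move=> b; rewrite -ra_actG mulgV ra_act1. Qed.

Let conjP g u : `[< is_multiplier (fun b => beta g (mR u (beta g^-1%g b)),
                                   fun b => beta g (mL u (beta g^-1%g b))) >].
Proof.
apply/asboolP; split=> a b; rewrite ?ra_actD ?mRD ?mLD ?ra_actD //.
- by rewrite ra_actM mRM ra_actM ra_actKV.
- by rewrite ra_actM mLM ra_actM ra_actKV.
- by rewrite -{1}[b](ra_actKV g) -ra_actM mRL ra_actM ra_actKV.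
Qed.

Definition mult_conj g u : M := Multiplier (conjP g u).

Lemma mR_conj g u b : mR (mult_conj g u) b = beta g (mR u (beta g^-1%g b)).
Proof. by []. Qed.
Lemma mL_conj g u b : mL (mult_conj g u) b = beta g (mL u (beta g^-1%g b)).
Proof. by []. Qed.

Lemma mult_conjM g u v : mult_conj g (u * v) = mult_conj g u * mult_conj g v.
Proof.
apply: mult_eq => b; first by rewrite mR_mul !mR_conj mR_mul ra_actK.
by rewrite mL_mul !mL_conj mL_mul ra_actK.
Qed.
Lemma mult_conj_1 g : mult_conj g 1 = 1.
Proof. by apply: mult_eq => b; rewrite (mR_conj, mL_conj); exact: ra_actKV. Qed.
Lemma mult_conj1 u : mult_conj 1%g u = u.
Proof. by apply: mult_eq => b; rewrite (mR_conj, mL_conj) invg1 !ra_act1. Qed.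
Lemma mult_conjG g h u : mult_conj (g * h)%g u = mult_conj g (mult_conj h u).
Proof.
by apply: mult_eq => b; rewrite !(mR_conj, mL_conj) invgM !ra_actG.
Qed.

End MultiplierRing.

Section EnvelopingCommutative.
Variables (G : groupType) (A : comPzRingType) (alpha : partial_action G A).
Variables (B : rngType) (beta : ring_action G B) (phi : A -> B).
Hypothesis E : enveloping_action alpha beta phi.

Let e := phi 1.

Let ideal_comm b : range phi b -> e ** b = b /\ b ** e = b.
Proof. by case=> a _ <-; rewrite /e -!(env_M E) mul1r mulr1. Qed.

Let e_central b : e ** b = b ** e.
Proof.
have [_ _ idE] := env_ideal E.
have /idE : range phi e by exists 1.
move=> /(_ b)[/ideal_comm[H _] /ideal_comm[_ H']].
by rewrite -H' -rmulA H.
Qed.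

Let mixed g a c : beta g (phi a) ** c = c ** beta g (phi a).
Proof.
have [_ _ idE] := env_ideal E.
rewrite -[c](ra_actKV beta g) -!ra_actM; congr (beta g _).
set d := beta _ c; have re : range phi e by exists 1.
have [ea ae] : e ** phi a = phi a /\ phi a ** e = phi a by apply: ideal_comm; exists a.
have [[a' _ eq_a'] _] := idE d e re.
rewrite -ae -rmulA e_central -eq_a' -(env_M E) mulrC (env_M E) eq_a'.
by rewrite -rmulA ea ae.
Qed.

Lemma env_rmulC : commutative (@rmul B).
Proof.
move=> b c; have [s ->] := env_sum E b.
by rewrite rmul_suml rmul_sumr; apply: eq_bigr => p _; apply: mixed.
Qed.

Lemma env_mulmC : commutative (@GRing.mul (multiplier B)).
Proof.
have LL (u v : multiplier B) a c : mL u (mL v (a ** c)) = mL u c ** mL v a.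
  by rewrite mLM env_rmulC mLM.
have RR (u v : multiplier B) a c : mR u (mR v (a ** c)) = mR u a ** mR v c.
  by rewrite mRM env_rmulC mRM env_rmulC.
have split b : exists s : seq (B * B), b = \sum_(p <- s) p.1 ** p.2.
  have [s ->] := env_sum E b.
  exists [seq (beta p.1 e, beta p.1 (phi p.2)) | p <- s].
  rewrite big_map; apply: eq_bigr => p _ /=.
  by rewrite -ra_actM /e -(env_M E) mul1r.
have sumL (u : multiplier B) (s : seq (B * B)) F :
    mL u (\sum_(p <- s) F p) = \sum_(p <- s) mL u (F p).
  apply: (big_morph _ (mLD u)).
  by apply: (addrI (mL u 0)); rewrite -mLD !addr0.
have sumR (u : multiplier B) (s : seq (B * B)) F :
    mR u (\sum_(p <- s) F p) = \sum_(p <- s) mR u (F p).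
  apply: (big_morph _ (mRD u)).
  by apply: (addrI (mR u 0)); rewrite -mRD !addr0.
move=> u v; apply: mult_eq => b; have [s ->] := split b.
  rewrite !mR_mul !sumR; apply: eq_bigr => p _.
  by rewrite [RHS]RR (env_rmulC p.1) [LHS]RR env_rmulC.
rewrite !mL_mul !sumL; apply: eq_bigr => p _.
by rewrite [RHS]LL (env_rmulC p.1) [LHS]LL env_rmulC.
Qed.

End EnvelopingCommutative.

(* The inverse of a in the ideal with identity e; the value is arbitrary (0) if
   a is not invertible there. *)
Definition invertible_in (A : comPzRingType) (e a : A) :=
  e * a = a /\ exists b, e * b = b /\ a * b = e.
Definition inv_in (A : comPzRingType) (e a : A) : A :=
  xget 0 [set b | e * b = b /\ a * b = e].

Section InvertibleIn.
Variables (A : comPzRingType).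
Implicit Types a b c e : A.

Lemma inv_inP e a : invertible_in e a -> e * inv_in e a = inv_in e a /\ a * inv_in e a = e.
Proof. by move=> [_ /(@xgetPex _ 0 [set b | _])]. Qed.

Lemma inv_in_eq e a b : e * b = b -> a * b = e -> inv_in e a = b.
Proof.
move=> eb ab; apply: xget_unique => //= c [ec ac].
by rewrite -eb -ac mulrAC ab.
Qed.

Lemma invertible_inV e a : invertible_in e a -> invertible_in e (inv_in e a).
Proof.
move=> ia; have [ei ai] := inv_inP ia.
by split=> //; exists a; case: ia => ea _; rewrite ea mulrC.
Qed.

Lemma invertible_inM e e' a b : e * e' = e ->
  invertible_in e a -> invertible_in e' b -> invertible_in e (a * b).
Proof.
move=> ee' [ea [a' [ea' aa']]] [eb [b' [eb' bb']]].
split; first by rewrite mulrA ea.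
by exists (a' * b'); split; [rewrite mulrA ea' | rewrite mulrACA aa' bb'].
Qed.

Lemma invertible_in_id e : e * e = e -> invertible_in e e.
Proof. by move=> ee; split=> //; exists e. Qed.

Lemma inv_inM e a b : invertible_in e a -> invertible_in e b ->
  inv_in e (a * b) = inv_in e a * inv_in e b.
Proof.
move=> ia ib; have [ea aa] := inv_inP ia; have [eb bb] := inv_inP ib.
have ee : e * e = e by rewrite -{2}aa mulrA ia.1 aa.
by apply: inv_in_eq; [rewrite mulrA ea | rewrite mulrACA aa bb].
Qed.

End InvertibleIn.

(* As a zmodType, this group is written additively: u + v is the product. *)
Record unit_group (R : comPzRingType) := UnitGroup {
  uval :> R;
  uvalP : `[< exists v : R, uval * v = 1 >]
}.

HB.instance Definition _ (R : comPzRingType) := [isSub for @uval R].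
HB.instance Definition _ (R : comPzRingType) := [Choice of unit_group R by <:].

Section UnitGroup.
Variable R : comPzRingType.
Local Notation U := (unit_group R).
Implicit Types u v w : U.

Let oneP : `[< exists v : R, 1 * v = 1 >].
Proof. by apply/asboolP; exists 1; rewrite mulr1. Qed.
Let mulP u v : `[< exists w : R, uval u * uval v * w = 1 >].
Proof.
case: u v => u /= /asboolP[u' uu'] [v /= /asboolP[v' vv']].
by apply/asboolP; exists (u' * v'); rewrite mulrACA uu' vv' mulr1.
Qed.
Let invP u : uval u * xget 0 [set v : R | uval u * v = 1] = 1.
Proof. by case: u => u /= /asboolP /(@xgetPex _ 0 [set v : R | u * v = 1]). Qed.
Let invP' u : `[< exists w : R, xget 0 [set v : R | uval u * v = 1] * w = 1 >].
Proof. by apply/asboolP; exists (uval u); rewrite mulrC invP. Qed.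

Definition unit_one : U := UnitGroup oneP.
Definition unit_mul u v : U := UnitGroup (mulP u v).
Definition unit_inv u : U := UnitGroup (invP' u).

Let mulA : associative unit_mul.
Proof. by move=> u v w; apply: val_inj; apply: mulrA. Qed.
Let mulC : commutative unit_mul.
Proof. by move=> u v; apply: val_inj; apply: mulrC. Qed.
Let mul1 : left_id unit_one unit_mul.
Proof. by move=> u; apply: val_inj; apply: mul1r. Qed.
Let mulV : left_inverse unit_one unit_inv unit_mul.
Proof. by move=> u; apply: val_inj; rewrite /= mulrC invP. Qed.

HB.instance Definition _ := GRing.isZmodule.Build U mulA mulC mul1 mulV.

End UnitGroup.

(* The composite of two consecutive cobd is 0 in the two instances below, but this
   is not a field: coboundary_pred is the subgroup of those cocycles that are
   coboundaries, so the quotient makes sense without it. *)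
Record cochain_data := CochainData {
  cochain : nat -> zmodType;
  cobd : forall n, {additive cochain n -> cochain n.+1}
}.

Section Cohomology.
Variable C : cochain_data.

Definition cocycle_pred n : {pred cochain C n} := fun c => cobd C n c == 0.

Lemma cocycle_closed n : zmod_closed (@cocycle_pred n).
Proof.
split=> [|c d]; rewrite /cocycle_pred !unfold_in ?raddf0 // raddfB.
by move=> /eqP-> /eqP->; rewrite subrr.
Qed.
HB.instance Definition _ n :=
  GRing.isZmodClosed.Build (cochain C n) (@cocycle_pred n) (@cocycle_closed n).

Definition cocycle n := {c : cochain C n | c \in @cocycle_pred n}.
HB.instance Definition _ n := [isSub of cocycle n for @sval _ _].
HB.instance Definition _ n := [Choice of cocycle n by <:].
HB.instance Definition _ n := [SubChoice_isSubZmodule of cocycle n by <:].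

(* There are no coboundaries but 0 in degree 0, so cohomology 0 is the quotient of
   the kernel of cobd 0 by the trivial subgroup. *)
Definition coboundary_pred n : {pred cocycle n} :=
  match n return pred (cocycle n) with
  | 0 => fun z => z == 0
  | m.+1 => fun z => `[< exists b : cochain C m, val z = cobd C m b >]
  end.

Lemma coboundary_closed n : zmod_closed (@coboundary_pred n).
Proof.
case: n => [|m]; split.
- by rewrite unfold_in /=.
- by move=> z w; rewrite !unfold_in /= => /eqP-> /eqP->; rewrite subrr.
- by apply/asboolP; exists 0; rewrite raddf0 raddf0.
move=> z w /asboolP[b zb] /asboolP[c wc]; apply/asboolP; exists (b - c).
by rewrite [RHS]raddfB -zb -wc -[RHS](raddfB val).
Qed.
HB.instance Definition _ n :=
  GRing.isZmodClosed.Build (cocycle n) (@coboundary_pred n) (@coboundary_closed n).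

Definition cohomology n : zmodType := Quotient.quot (@coboundary_pred n).

End Cohomology.

Definition isomorphic (U V : zmodType) := exists f : {additive U -> V}, bijective f.

Section Faces.
Variables (G : groupType) (n : nat).
Implicit Types x : n.+1.-tuple G.

(* (x_2, ..., x_{n+1}) *)
Definition face_first x : n.-tuple G := [tuple tnth x (lift ord0 k) | k < n].

(* (x_1, ..., x_i x_{i+1}, ..., x_{n+1}), where i is counted from 0 *)
Definition face_mul (i : 'I_n) x : n.-tuple G :=
  [tuple (if (k < i)%N then tnth x (widen_ord (leqnSn n) k)
          else if k == i
               then tnth x (widen_ord (leqnSn n) k) * tnth x (lift ord0 k)
               else tnth x (lift ord0 k))%g | k < n].

(* (x_1, ..., x_n) *)
Definition face_last x : n.-tuple G :=
  [tuple tnth x (widen_ord (leqnSn n) k) | k < n].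

End Faces.

Record gmodule (G : groupType) := GModule {
  gm_sort :> zmodType;
  gm_act : G -> gm_sort -> gm_sort;
  gm_actD : forall g a b, gm_act g (a + b) = gm_act g a + gm_act g b;
  gm_act1 : forall a, gm_act 1%g a = a;
  gm_actG : forall g h a, gm_act (g * h)%g a = gm_act g (gm_act h a)
}.

Section GroupCohomology.
Variables (G : groupType) (M : gmodule G).

Definition group_cobd n (f : n.-tuple G -> M) : n.+1.-tuple G -> M := fun x =>
  gm_act (tnth x ord0) (f (face_first x))
  + \sum_(i < n) f (face_mul i x) *~ (-1) ^+ i.+1
  + f (face_last x) *~ (-1) ^+ n.+1.

Lemma group_cobd_additive n : zmod_morphism (@group_cobd n).
Proof.
move=> f g; apply/funext => x.
change (group_cobd (f - g) x = group_cobd f x - group_cobd g x).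
rewrite /group_cobd; have actB h (a b : M) : gm_act h (a - b) = gm_act h a - gm_act h b.
  by apply: (addIr (gm_act h b)); rewrite -gm_actD !subrK.
rewrite actB mulrzBl; under eq_bigr do rewrite mulrzBl.
have rearr (a a' b b' c c' : M) :
  a - a' + (b - b') + (c - c') = a + b + c - (a' + b' + c').
  by rewrite !opprD [X in X + _ = _]addrACA [LHS]addrACA.
by rewrite sumrB rearr.
Qed.
HB.instance Definition _ n :=
  GRing.isZmodMorphism.Build _ _ (@group_cobd n) (@group_cobd_additive n).

Definition group_complex : cochain_data :=
  @CochainData (fun n => n.-tuple G -> M) (fun n => @group_cobd n).

End GroupCohomology.

Section PartialCohomology.
Variables (G : groupType) (A : comPzRingType) (alpha : unital_partial_action G A).
Local Notation "1_[ g ]" := (pa_one alpha g) (format "1_[ g ]").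

(* The idempotent 1_(x_1, ..., x_n), which is 1 for n = 0. *)
Definition pa_one_tuple n (x : n.-tuple G) : A :=
  \prod_(k < n) 1_[\prod_(y <- take k.+1 x) y]%g.

Lemma pa_domP g a : pa_dom alpha g a <-> 1_[g] * a = a.
Proof.
rewrite pa_domE; split=> [[b _ <-]|<-]; last by exists a.
by rewrite mulrA pa_one_idem.
Qed.

Lemma pa_one1 : 1_[1%g] = 1.
Proof.
have : pa_dom alpha 1%g 1 by rewrite pa_dom1.
by move=> /pa_domP; rewrite mulr1.
Qed.

Lemma pa_act_one g h : pa_act alpha g (1_[g^-1%g] * 1_[h]) = 1_[g] * 1_[(g * h)%g].
Proof.
have [_ _ actM] := pa_iso alpha g.
set u := 1_[g^-1%g] * _; set e := RHS.
have du : (pa_dom alpha g^-1%g `&` pa_dom alpha h) u.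
  by split; apply/pa_domP; [rewrite mulrA pa_one_idem | rewrite mulrCA pa_one_idem].
have : (pa_act alpha g @` (pa_dom alpha g^-1%g `&` pa_dom alpha h))
         (pa_act alpha g u) by exists u.
rewrite pa_actI => -[/pa_domP d1 /pa_domP d2].
have : (pa_dom alpha g `&` pa_dom alpha (g * h)%g) e.
  by split; apply/pa_domP; [rewrite mulrA pa_one_idem | rewrite mulrCA pa_one_idem].
rewrite -pa_actI => -[v [/[dup] dv /pa_domP v1 /pa_domP v2] ve].
have uv : u * v = v by rewrite /u -mulrA v2 v1.
have ev : pa_act alpha g u * e = e by rewrite -ve -actM ?uv //; case: du.
by rewrite -ev mulrC /e -mulrA d2 d1.
Qed.

Lemma pa_act_dom g a b :
  pa_act alpha g (1_[g^-1%g] * a * (1_[g^-1%g] * b)) =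
  pa_act alpha g (1_[g^-1%g] * a) * pa_act alpha g (1_[g^-1%g] * b).
Proof.
have [_ _ ->] // := pa_iso alpha g; apply/pa_domP;
  by rewrite mulrA pa_one_idem.
Qed.

Lemma pa_act_prod g n (h : 'I_n -> G) :
  pa_act alpha g (1_[g^-1%g] * \prod_(k < n) 1_[h k]) =
  1_[g] * \prod_(k < n) 1_[(g * h k)%g].
Proof.
elim: n h => [|n IH] h.
  by rewrite !big_ord0 -pa_one1 pa_act_one mulg1 pa_one1 mulr1 pa_one_idem.
rewrite !big_ord_recr /= -{1}[1_[_]]pa_one_idem mulrACA pa_act_dom IH.
by rewrite pa_act_one mulrACA pa_one_idem.
Qed.

Let prefix_nth n (x : n.-tuple G) k : (k <= n)%N ->
  (\prod_(y <- take k x) y = \prod_(0 <= j < k) nth 1 x j)%g.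
Proof.
move=> kn; have szk : size (take k x) = k by rewrite size_takel ?size_tuple.
rewrite (big_nth 1%g) szk; apply: eq_big_nat => j /andP[_ jk].
by rewrite nth_take.
Qed.

Lemma pa_one_tuple_absorb n (x : n.-tuple G) k : (k < n)%N ->
  pa_one_tuple x * 1_[\prod_(y <- take k.+1 x) y]%g = pa_one_tuple x.
Proof.
move=> kn; rewrite /pa_one_tuple (bigD1 (Ordinal kn)) //=.
by rewrite mulrAC pa_one_idem.
Qed.

Let pa_one_tuple_sub n m (x : n.-tuple G) (y : m.-tuple G) :
  (forall k, (k < m)%N -> exists2 j, (j < n)%N &
     \prod_(z <- take k.+1 y) z = \prod_(z <- take j.+1 x) z)%g ->
  pa_one_tuple x * pa_one_tuple y = pa_one_tuple x.
Proof.
move=> H; apply: (big_ind (fun a => pa_one_tuple x * a = pa_one_tuple x)).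
- by rewrite mulr1.
- by move=> a b xa xb; rewrite mulrA xa.
by move=> k _; have [j jn ->] := H k (ltn_ord k); apply: pa_one_tuple_absorb.
Qed.

Lemma pa_one_tuple_idem n (x : n.-tuple G) :
  pa_one_tuple x * pa_one_tuple x = pa_one_tuple x.
Proof. by apply: pa_one_tuple_sub => k kn; exists k. Qed.

Lemma pa_one_tuple_face_last n (x : n.+1.-tuple G) :
  pa_one_tuple x * pa_one_tuple (face_last x) = pa_one_tuple x.
Proof.
apply: pa_one_tuple_sub => k kn; exists k; first exact: ltnW.
rewrite !prefix_nth //; last exact: ltnW.
apply: eq_big_nat => j /andP[_ jk]; have jn : (j < n)%N by apply: leq_trans kn.
rewrite -[j]/(nat_of_ord (Ordinal jn)) -tnth_nth tnth_mktuple.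
by rewrite (tnth_nth 1%g).
Qed.

Lemma pa_one_tuple_face_mul n (i : 'I_n) (x : n.+1.-tuple G) :
  pa_one_tuple x * pa_one_tuple (face_mul i x) = pa_one_tuple x.
Proof.
have face_nth j : (j < n)%N -> (nth 1 (face_mul i x) j =
    if (j < i)%N then nth 1 x j
    else if j == i then nth 1 x j * nth 1 x j.+1 else nth 1 x j.+1)%g.
  move=> jn; rewrite -[in LHS](erefl : nat_of_ord (Ordinal jn) = j) -tnth_nth.
  by rewrite tnth_mktuple !(tnth_nth 1%g) /= /bump leq0n add1n.
have prefix k : (k < n)%N -> (\prod_(0 <= j < k.+1) nth 1 (face_mul i x) j =
    \prod_(0 <= j < (if (k < i)%N then k.+1 else k.+2)) nth 1 x j)%g.
  elim: k => [|k IH] kn.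
    rewrite big_nat1 face_nth // eq_sym; case: (ltngtP 0 i) => // i0.
      by rewrite big_nat1.
    by rewrite big_nat_recr //= big_nat1.
  rewrite big_nat_recr //= IH ?(ltnW kn) // face_nth //.
  case: (ltngtP k.+1 i) => ik.
  - by rewrite [RHS]big_nat_recr.
  - by rewrite [RHS]big_nat_recr.
  - by rewrite [RHS]big_nat_recr //= [in RHS]big_nat_recr //= mulgA.
apply: pa_one_tuple_sub => k kn.
exists (if (k < i)%N then k else k.+1); first by case: ifP => // _; apply: ltnW.
rewrite !prefix_nth //; last by case: ifP => // _; apply: ltnW.
by rewrite prefix //; case: ifP.
Qed.

Lemma pa_one_tuple_face_first n (x : n.+1.-tuple G) :
  pa_act alpha (tnth x ord0)
    (1_[(tnth x ord0)^-1%g] * pa_one_tuple (face_first x)) = pa_one_tuple x.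
Proof.
rewrite pa_act_prod /pa_one_tuple big_ord_recl; congr (1_[_] * _).
  by rewrite prefix_nth // big_nat1 (tnth_nth 1%g).
apply: eq_bigr => k _; congr 1_[_].
rewrite !prefix_nth // [RHS]big_nat_recl // (tnth_nth 1%g); congr (_ * _)%g.
apply: eq_big_nat => j /andP[_ jk].
have jn : (j < n)%N by apply: leq_trans (ltn_ord k).
by rewrite -[in LHS](erefl : nat_of_ord (Ordinal jn) = j) -tnth_nth tnth_mktuple (tnth_nth 1%g).
Qed.

(* C^n(G, A). Being a zmodType, it is written additively: the sum of two cochains
   is their pointwise product. *)
Record pcochain n := PCochain {
  pcval :> n.-tuple G -> A;
  pcvalP : `[< forall x, invertible_in (pa_one_tuple x) (pcval x) >]
}.

HB.instance Definition _ n := [isSub for @pcval n].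
HB.instance Definition _ n := [Choice of pcochain n by <:].

Lemma pcochainP n (f : pcochain n) x : invertible_in (pa_one_tuple x) (f x).
Proof. by move/asboolP: (pcvalP f); apply. Qed.

Section PCochainZmod.
Variable n : nat.
Implicit Types f g h : pcochain n.

Let oneP :
  `[< forall x : n.-tuple G, invertible_in (pa_one_tuple x) (pa_one_tuple x) >].
Proof.
by apply/asboolP => x; apply: invertible_in_id; apply: pa_one_tuple_idem.
Qed.
Let mulP f g : `[< forall x, invertible_in (pa_one_tuple x) (f x * g x) >].
Proof.
by apply/asboolP => x; apply: invertible_inM (pa_one_tuple_idem x) _ _;
  apply: pcochainP.
Qed.
Let invP f :
  `[< forall x, invertible_in (pa_one_tuple x) (inv_in (pa_one_tuple x) (f x)) >].
Proof. by apply/asboolP => x; apply: invertible_inV; apply: pcochainP. Qed.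

Definition pcochain_one : pcochain n := PCochain oneP.
Definition pcochain_mul f g : pcochain n := PCochain (mulP f g).
Definition pcochain_inv f : pcochain n := PCochain (invP f).

Let mulA : associative pcochain_mul.
Proof. by move=> f g h; apply/val_inj/funext => x; apply: mulrA. Qed.
Let mulC : commutative pcochain_mul.
Proof. by move=> f g; apply/val_inj/funext => x; apply: mulrC. Qed.
Let mul1 : left_id pcochain_one pcochain_mul.
Proof. by move=> f; apply/val_inj/funext => x; case: (pcochainP f x). Qed.
Let mulV : left_inverse pcochain_one pcochain_inv pcochain_mul.
Proof.
move=> f; apply/val_inj/funext => x; rewrite /= mulrC.
by case: (inv_inP (pcochainP f x)).
Qed.

HB.instance Definition _ := GRing.isZmodule.Build (pcochain n) mulA mulC mul1 mulV.

End PCochainZmod.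

(* f(x)^((-1)^k), the inverse being taken in the ideal D_x *)
Definition pcochain_sgn n (f : pcochain n) (k : nat) (x : n.-tuple G) : A :=
  if odd k then inv_in (pa_one_tuple x) (f x) else f x.

Lemma pcochain_sgnP n (f : pcochain n) k x :
  invertible_in (pa_one_tuple x) (pcochain_sgn f k x).
Proof.
by rewrite /pcochain_sgn; case: ifP => _; [apply: invertible_inV|]; apply: pcochainP.
Qed.

Lemma pcochain_sgnM n (f g : pcochain n) k x :
  pcochain_sgn (f + g) k x = pcochain_sgn f k x * pcochain_sgn g k x.
Proof.
by rewrite /pcochain_sgn; case: ifP => _ //; apply: inv_inM; apply: pcochainP.
Qed.

Definition pcobd_fun n (f : pcochain n) (x : n.+1.-tuple G) : A :=
  pa_act alpha (tnth x ord0) (1_[(tnth x ord0)^-1%g] * f (face_first x))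
  * \prod_(i < n) pcochain_sgn f i.+1 (face_mul i x)
  * pcochain_sgn f n.+1 (face_last x).

Lemma pcobdP n (f : pcochain n) :
  `[< forall x, invertible_in (pa_one_tuple x) (pcobd_fun f x) >].
Proof.
apply/asboolP => x; have first_inv : invertible_in (pa_one_tuple x)
    (pa_act alpha (tnth x ord0) (1_[(tnth x ord0)^-1%g] * f (face_first x))).
  have [ef [f' [ef' ff']]] := pcochainP f (face_first x).
  rewrite -pa_one_tuple_face_first; set g := tnth x ord0; split.
    by rewrite -pa_act_dom mulrACA pa_one_idem ef.
  exists (pa_act alpha g (1_[g^-1%g] * f')).
  by rewrite -!pa_act_dom; split; rewrite mulrACA pa_one_idem ?ef' ?ff'.
apply: invertible_inM (pa_one_tuple_face_last x) _ (pcochain_sgnP _ _ _).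
rewrite mulrC; move: first_inv; set a := pa_act _ _ _; move: a.
apply: (big_ind (fun p => forall a, invertible_in (pa_one_tuple x) a ->
                            invertible_in (pa_one_tuple x) (p * a))).
- by move=> a; rewrite mul1r.
- by move=> p q Hp Hq a ia; rewrite -mulrA; apply: Hp; apply: Hq.
move=> i _ a ia; rewrite mulrC.
exact: invertible_inM (pa_one_tuple_face_mul i x) ia (pcochain_sgnP _ _ _).
Qed.

Definition pcobd n (f : pcochain n) : pcochain n.+1 := PCochain (pcobdP f).

Lemma pcobd_additive n : zmod_morphism (@pcobd n).
Proof.
have pcobdD (f g : pcochain n) : pcobd (f + g) = pcobd f + pcobd g.
  apply/val_inj/funext => x.
  change (pcobd_fun (f + g) x = pcobd_fun f x * pcobd_fun g x).
  rewrite /pcobd_fun pcochain_sgnM; under eq_bigr do rewrite pcochain_sgnM.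
  rewrite big_split /= [RHS]mulrACA [X in _ = X * _]mulrACA -pa_act_dom.
  by rewrite [X in _ = pa_act _ _ X * _ * _]mulrACA pa_one_idem.
by move=> f g; apply: (addIr (pcobd g)); rewrite -pcobdD !subrK.
Qed.
HB.instance Definition _ n :=
  GRing.isZmodMorphism.Build _ _ (@pcobd n) (@pcobd_additive n).

Definition partial_complex : cochain_data :=
  @CochainData pcochain (fun n => @pcobd n).

End PartialCohomology.

Section UnitMultipliers.
Variables (G : groupType) (A : comPzRingType) (alpha : partial_action G A).
Variables (B : rngType) (beta : ring_action G B) (phi : A -> B).
Variable E : enveloping_action alpha beta phi.

(* M(B); the argument E provides the commutativity. *)
Definition mult_ring of enveloping_action alpha beta phi : Type := multiplier B.
HB.instance Definition _ := GRing.PzRing.on (mult_ring E).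
HB.instance Definition _ :=
  GRing.PzRing_hasCommutativeMul.Build (mult_ring E) (env_mulmC E).

Local Notation U := (unit_group (mult_ring E)).

Let unit_conjP g (u : U) :
  `[< exists v : mult_ring E, (mult_conj beta g (uval u) : mult_ring E) * v = 1 >].
Proof.
case: u => u /= /asboolP[v uv]; apply/asboolP; exists (mult_conj beta g v).
by rewrite -[LHS]mult_conjM -[1]/(1 : multiplier B) -(mult_conj_1 beta g) -uv.
Qed.

Definition unit_conj g (u : U) : U := UnitGroup (unit_conjP g u).

Let unit_conjD g u v : unit_conj g (u + v) = unit_conj g u + unit_conj g v.
Proof. by apply: val_inj; apply: mult_conjM. Qed.
Let unit_conj1 u : unit_conj 1%g u = u.
Proof. by apply: val_inj; apply: mult_conj1. Qed.
Let unit_conjG g h u : unit_conj (g * h)%g u = unit_conj g (unit_conj h u).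
Proof. by apply: val_inj; apply: mult_conjG. Qed.

Definition unit_mult_gmodule : gmodule G := GModule unit_conjD unit_conj1 unit_conjG.

End UnitMultipliers.

(* Main.v *)
(** Both complexes can be compared inside [A]. Restricting multipliers to the
    ideal [phi A] turns global cochains into partial ones; this is a surjective
    chain map, so it suffices that its kernel is exact. A unit [u] of [M(B)] is the
    same thing as the family of the restrictions to [A] of its translates by [G],
    and every compatible family in [U(A)] comes from such a [u]. Hence a global
    cochain, in homogeneous form, becomes an invariant function
    [Phi (g_0, ..., g_n)] with values in [U(A)], and it restricts to the trivial
    partial cochain iff the coordinate of [Phi (g_0, ..., g_n)] at [l] is trivial
    whenever every [1_(g_i)] is nonzero at [l]. For each [l] there is a map
    [p_l : G -> G] onto the set of those [g] with [1_g] nonzero at [l], fixing this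
    set pointwise, and the [p_l] can be chosen equivariantly; the prism homotopy
    between the identity and [p_l], taken coordinate by coordinate, contracts the
    kernel. Products of indecomposable rings enter because their unit groups allow
    this coordinatewise definition and because the partial action permutes the
    coordinates. *)

Require Import Defs.
From HB Require Import structures.
From mathcomp Require Import all_boot all_order all_algebra all_classical ssrAC.

Set Implicit Arguments.
Unset Strict Implicit.
Unset Printing Implicit Defensive.

Import GRing.Theory.
Local Open Scope quotient_scope.
Local Open Scope ring_scope.

(** * Surjective chain maps with exact kernel *)

Section ComplexSurjection.
Variables (C D : cochain_data) (r : forall n, {additive cochain C n -> cochain D n}).
Hypothesis r_cobd : forall n c, r n.+1 (cobd C n c) = cobd D n (r n c).
Hypothesis cobd_cobd : forall n c, cobd C n.+1 (cobd C n c) = 0.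
Hypothesis r_surj : forall n d, exists c, r n c = d.
Hypothesis ker_exact0 : forall c, r 0 c = 0 -> cobd C 0 c = 0 -> c = 0.
Hypothesis ker_exactS : forall n c, r n.+1 c = 0 -> cobd C n.+1 c = 0 ->
  exists2 k, r n k = 0 & cobd C n k = c.

Lemma cocycle_cobd (X : cochain_data) n (z : cocycle X n) : cobd X n (val z) = 0.
Proof. by apply/eqP; exact: valP z. Qed.

Lemma cobd_cocycle (X : cochain_data) n (c : cochain X n) :
  cobd X n c = 0 -> c \in @cocycle_pred X n.
Proof. by move/eqP. Qed.

Lemma res_cocycleP n (z : cocycle C n) : cobd D n (r n (val z)) = 0.
Proof. by rewrite -r_cobd cocycle_cobd raddf0. Qed.

Definition res_cocycle n (z : cocycle C n) : cocycle D n :=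
  Sub (r n (val z)) (cobd_cocycle (res_cocycleP z)).

Lemma res_cocycleB n : zmod_morphism (@res_cocycle n).
Proof. by move=> z w; apply: val_inj; rewrite /= !raddfB. Qed.
HB.instance Definition _ n :=
  GRing.isZmodMorphism.Build _ _ (@res_cocycle n) (@res_cocycleB n).

(** A cochain [c] lifting the cocycle has its coboundary in the kernel of [r], where it is also the
    coboundary of some [k]; then [c - k] is a cocycle with the same image. *)
Lemma res_cocycle_surj n (z : cocycle D n) : exists w, res_cocycle w == z.
Proof.
have [c cz] := r_surj (val z).
have [k k0 kc] : exists2 k, r n k = 0 & cobd C n k = cobd C n c.
  by apply: ker_exactS => //; rewrite r_cobd cz cocycle_cobd.
have ck : cobd C n (c - k) = 0 by rewrite raddfB kc subrr.
exists (Sub (c - k) (cobd_cocycle ck)); apply/eqP/val_inj.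
by rewrite /= raddfB k0 subr0.
Qed.

(** With surjectivity on cocycles, this makes the induced map on cohomology bijective. In positive
    degree, subtracting from [z] the coboundary of a lift of [b] leaves a cocycle in the kernel of
    [r], hence a coboundary. *)
Lemma res_coboundary n (z : cocycle C n) :
  (res_cocycle z \in @coboundary_pred D n) = (z \in @coboundary_pred C n).
Proof.
case: n z => [|n] z; rewrite !unfold_in /=.
  apply/eqP/eqP => [/(congr1 val) /= z0|->]; last by rewrite raddf0.
  by apply: val_inj; apply: ker_exact0 => //; apply: cocycle_cobd.
apply/asboolP/asboolP => -[b zb]; last by exists (r n b); rewrite /= zb r_cobd.
have [c cb] := r_surj b.
have [||k _ kc] := @ker_exactS n (val z - cobd C n c).
- by rewrite raddfB r_cobd cb -zb subrr.
- by rewrite raddfB cobd_cobd cocycle_cobd subrr.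
by exists (k + c); rewrite raddfD /= kc subrK.
Qed.

Lemma isomorphic_cohomology n : isomorphic (cohomology D n) (cohomology C n).
Proof.
(* The isomorphism lifts representatives from [D] to [C]; by [res_coboundary] the class of the lift
   does not depend on the choices. *)
pose w (z : cocycle D n) := xchoose (res_cocycle_surj z).
have wK z : res_cocycle (w z) = z by apply/eqP; exact: xchooseP (res_cocycle_surj z).
pose HC := Quotient.quot (@coboundary_pred C n).
pose HD := Quotient.quot (@coboundary_pred D n).
pose T (x : HD) : HC := \pi_HC (w (repr x)).
pose S (y : HC) : HD := \pi_HD (res_cocycle (repr y)).
have eqC (a b : cocycle C n) : res_cocycle a = res_cocycle b %[mod HD] ->
    a = b %[mod HC].
  move/eqP; rewrite -Quotient.idealrBE -raddfB res_coboundary Quotient.idealrBE.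
  by move/eqP.
have eqD (a b : cocycle C n) : a = b %[mod HC] ->
    res_cocycle a = res_cocycle b %[mod HD].
  move/eqP; rewrite -Quotient.idealrBE -res_coboundary raddfB Quotient.idealrBE.
  by move/eqP.
have TB : zmod_morphism T.
  move=> x y; rewrite /T -raddfB; apply: eqC.
  by rewrite (raddfB (@res_cocycle n)) (raddfB \pi_HD) /= !wK !reprK.
pose TM := GRing.isZmodMorphism.Build _ _ T TB.
pose T' : {additive HD -> HC} := HB.pack T TM.
exists T'; exists S => [x|y]; rewrite /= /T /S.
  rewrite -[RHS]reprK -[in RHS](wK (repr x)); apply: eqD; exact: reprK.
by rewrite -[RHS]reprK; apply: eqC; rewrite wK reprK.
Qed.

End ComplexSurjection.

(** * The prism homotopy *)

Section ListCochains.
Variables (T : Type) (V : zmodType).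
Implicit Types (F : seq T -> V) (s : seq T).

Definition rem_nth i s := take i s ++ drop i.+1 s.

Lemma size_rem_nth i s : (i < size s)%N -> size (rem_nth i s) = (size s).-1.
Proof.
move=> lt_is; rewrite size_cat size_takel ?size_drop 1?ltnW //.
by rewrite subnS -subn1 addnBA ?subn_gt0 // subnKC ?subn1 // ltnW.
Qed.

Lemma nth_rem_nth x0 i s k : (i < size s)%N ->
  nth x0 (rem_nth i s) k = if (k < i)%N then nth x0 s k else nth x0 s k.+1.
Proof.
move=> lt_is; rewrite nth_cat (size_takel (ltnW lt_is)); case: ltnP => [ki|ik].
  by rewrite nth_take.
by rewrite nth_drop addSn subnKC.
Qed.

Definition list_cobd F s := \sum_(i < size s) F (rem_nth i s) *~ (-1) ^+ i.

Lemma eq_list_cobd F F' s :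
    (forall t, size t = (size s).-1 -> F t = F' t) ->
  list_cobd F s = list_cobd F' s.
Proof. by move=> eqF; apply: eq_bigr => i _; rewrite eqF // size_rem_nth. Qed.

(** This recursion lets the identities below go by induction on the list, with no double sums over
    pairs of indices. *)
Lemma list_cobd_cons F g s :
  list_cobd F (g :: s) = F s - list_cobd (fun t => F (g :: t)) s.
Proof.
rewrite /list_cobd /= big_ord_recl /rem_nth /= drop0 mulr1z; congr (_ + _).
rewrite -sumrN; apply: eq_bigr => i _.
by rewrite /rem_nth /= /bump /= add1n exprS mulN1r mulrNz.
Qed.

Lemma list_cobd_nil F : list_cobd F [::] = 0.
Proof. by rewrite /list_cobd big_ord0. Qed.

Lemma list_cobdB F F' s :
  list_cobd (fun t => F t - F' t) s = list_cobd F s - list_cobd F' s.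
Proof. by rewrite -sumrB; apply: eq_bigr => i _; rewrite mulrzBl. Qed.

Lemma list_cobd_map F (p : T -> T) s :
  list_cobd (F \o map p) s = list_cobd F (map p s).
Proof.
rewrite /list_cobd size_map; apply: eq_bigr => i _.
by rewrite /= /rem_nth map_cat map_take map_drop.
Qed.

Lemma list_cobd_cobd F s : list_cobd (list_cobd F) s = 0.
Proof.
elim: s F => [|g s IH] F; first exact: list_cobd_nil.
rewrite list_cobd_cons.
under [X in _ - X]eq_list_cobd => t _ do rewrite list_cobd_cons.
by rewrite list_cobdB IH subr0 subrr.
Qed.

(** The classical prism operator: the [i]-th term repeats entry [i], first as it is and then under
    [p]. *)
Definition prism (p : T -> T) F s :=
  \sum_(i < size s) F (take i.+1 s ++ map p (drop i s)) *~ (-1) ^+ i.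

Lemma prism_cons p F g s :
  prism p F (g :: s) = F [:: g, p g & map p s] - prism p (fun t => F (g :: t)) s.
Proof.
rewrite /prism /= big_ord_recl /= take0 mulr1z; congr (_ + _).
rewrite -sumrN; apply: eq_bigr => i _.
by rewrite /bump /= add1n exprS mulN1r mulrNz.
Qed.

Lemma prismB p F F' s :
  prism p (fun t => F t - F' t) s = prism p F s - prism p F' s.
Proof. by rewrite -sumrB; apply: eq_bigr => i _; rewrite mulrzBl. Qed.

Lemma eq_prism p F F' s : F =1 F' -> prism p F s = prism p F' s.
Proof. by move=> eqF; apply: eq_bigr => i _; rewrite eqF. Qed.

Lemma size_prism (p : T -> T) i s : (i < size s)%N ->
  size (take i.+1 s ++ map p (drop i s)) = (size s).+1.
Proof.
move=> lt_is; rewrite size_cat size_map size_takel // size_drop.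
by rewrite addSn subnKC // ltnW.
Qed.

Lemma prism0 p F s : (forall t, size t = (size s).+1 -> F t = 0) -> prism p F s = 0.
Proof. by move=> F0; rewrite /prism big1 // => i _; rewrite F0 ?mul0rz // size_prism. Qed.

(** Both recursions are unfolded at the head [g], and the induction hypothesis is used for
    [F (g :: _)]; the terms in which [F] starts with [g] and [p g] cancel. *)
Lemma prism_homotopy p F s :
  list_cobd (prism p F) s + prism p (list_cobd F) s = F (map p s) - F s.
Proof.
elim: s F => [|g s IH] F.
  by rewrite list_cobd_nil /prism big_ord0 addr0 subrr.
rewrite list_cobd_cons prism_cons !list_cobd_cons.
under [X in _ - X + _]eq_list_cobd => t _ do rewrite prism_cons.
under [X in _ + (_ - X)]eq_prism => t do rewrite list_cobd_cons.
rewrite list_cobdB prismB -(list_cobd_map (fun t => F [:: g, p g & t])).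
move: (IH (fun t => F (g :: t))) => /(canRL (addrK _)) ->.
set a := list_cobd _ s; set b := prism p F s; set c := prism p _ s.
rewrite /= !opprB !opprD !opprK.
set x := F (g :: s); set y := F (g :: map _ _).
(* Of the ten terms, the two that survive come first, followed by four cancelling pairs. *)
rewrite !addrA [LHS](ACl (6*4*(1*10)*(2*7)*(3*9)*(5*8)))/=.
by rewrite !subrr !addNr !addr0.
Qed.

End ListCochains.

(** * Homogeneous cochains *)

Section HomogeneousCochains.
Local Open Scope group_scope.
Variables (G : groupType) (M : gmodule G).

(** Inhomogeneous coordinates of the homogeneous tuple [g :: s]; partial products starting from [g]
    recover [s]. *)
Definition quotients (g : G) (s : seq G) := pairmap (fun a b => a^-1 * b) g s.

Lemma quotientsK g s : scanl *%g g (quotients g s) = s.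
Proof. by apply: pairmapK => x y; rewrite mulVKg. Qed.

Lemma scanl_quotients g s : quotients g (scanl *%g g s) = s.
Proof. by apply: scanlK => x y; rewrite mulKg. Qed.

Lemma quotientsM k g s : quotients (k * g) (map ( *%g k) s) = quotients g s.
Proof. by elim: s g => //= h s IH g; rewrite IH invgM -mulgA mulKg. Qed.

Lemma map_scanl_mul (k g : G) s : map ( *%g k) (scanl *%g g s) = scanl *%g (k * g) s.
Proof. by elim: s g => //= h s IH g; rewrite IH mulgA. Qed.

Lemma size_quotients g s : size (quotients g s) = size s.
Proof. exact: size_pairmap. Qed.

Section Faces.
Variables (n : nat) (x : n.+1.-tuple G) (g : G) (s : seq G).
Hypothesis xE : val x = quotients g s.

Let size_s : size s = n.+1. Proof. by rewrite -(size_quotients g) -xE size_tuple. Qed.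

Let nth_x k : (k < n.+1)%N -> nth 1 x k = (nth 1 (g :: s) k)^-1 * nth 1 s k.
Proof. by move=> kn; rewrite [tval x]xE (nth_pairmap 1) ?size_s. Qed.

Lemma quotients_face_first : val (face_first x) = quotients (head 1 s) (behead s).
Proof.
have size_t : size (behead s) = n by rewrite size_behead size_s.
apply: (@eq_from_nth _ 1); first by rewrite size_tuple size_quotients size_t.
move=> k; rewrite size_tuple => kn.
rewrite -[k]/(nat_of_ord (Ordinal kn)) -tnth_nth tnth_mktuple (tnth_nth 1) /=.
rewrite nth_x // (nth_pairmap 1) ?size_t // nth_behead.
by case: s size_s.
Qed.

Lemma quotients_face_mul (i : 'I_n) : val (face_mul i x) = quotients g (rem_nth i s).
Proof.
have i_s : (i < size s)%N by rewrite size_s; apply: leq_trans (ltn_ord i) _.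
apply: (@eq_from_nth _ 1).
  by rewrite size_tuple size_quotients size_rem_nth // size_s.
move=> k; rewrite size_tuple => kn.
rewrite -[k in LHS]/(nat_of_ord (Ordinal kn)) -tnth_nth tnth_mktuple !(tnth_nth 1) /=.
rewrite /bump /= add1n (nth_pairmap 1) ?size_rem_nth ?size_s //.
rewrite -[g :: _]/(rem_nth i.+1 (g :: s)) !nth_rem_nth //=.
have kn1 : (k < n.+1)%N := ltnW kn.
rewrite !(nth_x kn1, @nth_x k.+1 kn) -val_eqE /= !ltnS.
  by case: ltngtP => //= _; rewrite -mulgA mulVKg.
exact: leq_trans (ltn_ord i) _.
Qed.

Lemma quotients_face_last : val (face_last x) = quotients g (rem_nth n s).
Proof.
have n_s : (n < size s)%N by rewrite size_s.
apply: (@eq_from_nth _ 1).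
  by rewrite size_tuple size_quotients size_rem_nth // size_s.
move=> k; rewrite size_tuple => kn.
rewrite -[k in LHS]/(nat_of_ord (Ordinal kn)) -tnth_nth tnth_mktuple !(tnth_nth 1) /=.
rewrite (nth_pairmap 1) ?size_rem_nth ?size_s //.
rewrite -[g :: _]/(rem_nth n.+1 (g :: s)) !nth_rem_nth //=.
by rewrite (nth_x (ltnW kn : k < n.+1)%N) kn ltnS ltnW.
Qed.
End Faces.

Lemma gm_act_additive (k : G) : zmod_morphism (gm_act k : M -> M).
Proof. by move=> b c; apply: (addIr (gm_act k c)); rewrite -gm_actD !subrK. Qed.
HB.instance Definition _ k :=
  GRing.isZmodMorphism.Build M M (gm_act k) (gm_act_additive k).

(* f extended by the junk value 0 to lists of the wrong length *)
Definition on_lists n (f : n.-tuple G -> M) (s : seq G) : M :=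
  if insub s is Some x then f x else 0%R.

Lemma on_listsE n (f : n.-tuple G -> M) (x : n.-tuple G) : on_lists f (val x) = f x.
Proof. by rewrite /on_lists valK. Qed.

(** The standard homogeneous form [g_0 . f (g_0^-1 g_1, ..., g_(n-1)^-1 g_n)]. The default [1] only
    concerns the empty list. *)
Definition homogeneous n (f : n.-tuple G -> M) (s : seq G) : M :=
  gm_act (head 1 s) (on_lists f (quotients (head 1 s) (behead s))).

Lemma homogeneousB n (f f' : n.-tuple G -> M) s :
  homogeneous (f - f')%R s = (homogeneous f s - homogeneous f' s)%R.
Proof.
rewrite /homogeneous -raddfB /on_lists.
by case: insub => [x|]; rewrite ?subrr.
Qed.

Lemma homogeneous_scanl n (f : n.-tuple G -> M) g (x : n.-tuple G) :
  homogeneous f (g :: scanl *%g g x) = gm_act g (f x).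
Proof. by rewrite /homogeneous /= scanl_quotients on_listsE. Qed.

Lemma homogeneousM n (f : n.-tuple G -> M) k s : (0 < size s)%N ->
  homogeneous f (map ( *%g k) s) = gm_act k (homogeneous f s).
Proof. by case: s => // g s _; rewrite /homogeneous /= quotientsM gm_actG. Qed.

(** Each face of the quotients deletes one entry of [g :: s]. Deleting [g] itself moves the base
    point to [g * x_1], which accounts for the action in the first summand of the coboundary. *)
Lemma list_cobd_homogeneous n (f : n.-tuple G -> M) s : size s = n.+2 ->
  list_cobd (homogeneous f) s = homogeneous (group_cobd f) s.
Proof.
case: s => // g s [size_s]; rewrite list_cobd_cons.
have size_x : size (quotients g s) == n.+1 by rewrite size_quotients size_s.
pose x := Tuple size_x; have xE : val x = quotients g s by [].
rewrite /homogeneous /= -xE on_listsE /group_cobd -addrA !gm_actD; congr (_ + _)%R.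
  rewrite -(quotients_face_first xE) on_listsE -gm_actG; congr (gm_act _ _).
  by rewrite (tnth_nth 1) /=; case: s size_s {size_x x xE} => //= h s _; rewrite mulVKg.
rewrite /list_cobd size_s big_ord_recr /= opprD; congr (_ + _)%R; last first.
  by rewrite -(quotients_face_last xE) on_listsE (raddfMz (gm_act g)) exprS mulN1r mulrNz.
rewrite (raddf_sum (gm_act g)) -sumrN; apply: eq_bigr => i _.
by rewrite -(quotients_face_mul xE) on_listsE (raddfMz (gm_act g)) exprS mulN1r mulrNz.
Qed.

Lemma homogeneous_inj n (f f' : n.-tuple G -> M) :
  (forall s, size s = n.+1 -> homogeneous f s = homogeneous f' s) -> f =1 f'.
Proof.
move=> eqf x; have := eqf (1 :: scanl *%g 1 x).
by rewrite !homogeneous_scanl !gm_act1 /= size_scanl size_tuple; apply.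
Qed.

Lemma group_cobd_cobd n (f : n.-tuple G -> M) x : group_cobd (group_cobd f) x = 0%R.
Proof.
move: x; apply: (@homogeneous_inj _ _ (fun=> 0%R)) => s size_s.
rewrite -list_cobd_homogeneous // (@eq_list_cobd _ _ _ (list_cobd (homogeneous f))).
  rewrite list_cobd_cobd /homogeneous /on_lists.
  by case: insub => [_|]; rewrite raddf0.
by move=> t; rewrite size_s => size_t; rewrite list_cobd_homogeneous.
Qed.

End HomogeneousCochains.

(** * Units of the multiplier ring *)

Section UnitGroups.
Variable R : comPzRingType.

Lemma unit_groupP (u : R) : (exists v, u * v = 1) -> exists w : unit_group R, uval w = u.
Proof. by move=> /asboolP uP; exists (UnitGroup uP). Qed.

Lemma uval_inj : injective (@uval R).
Proof. exact: val_inj. Qed.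

Lemma uvalD (u v : unit_group R) : uval (u + v) = uval u * uval v.
Proof. by []. Qed.

Lemma uvalN (u : unit_group R) : uval u * uval (- u) = 1.
Proof. by rewrite -uvalD subrr. Qed.

End UnitGroups.

Section UnitMap.
Variables (R S : comPzRingType) (f : {rmorphism R -> S}).

Lemma unit_mapP (u : unit_group R) : `[< exists v, f (uval u) * v = 1 >].
Proof. by apply/asboolP; exists (f (uval (- u))); rewrite -rmorphM uvalN rmorph1. Qed.

Definition unit_map u : unit_group S := UnitGroup (unit_mapP u).

Lemma unit_map_additive : zmod_morphism unit_map.
Proof.
move=> u v; apply: (addIr (unit_map v)); rewrite subrK; apply: uval_inj.
by rewrite uvalD -rmorphM -uvalD subrK.
Qed.
HB.instance Definition _ := GRing.isZmodMorphism.Build _ _ unit_map unit_map_additive.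

End UnitMap.

Section RngMultipliers.
Variable B : rngType.

Let mult_rngP (c : B) : `[< is_multiplier (fun b => b ** c, fun b => c ** b) >].
Proof. by apply/asboolP; split=> a b; rewrite ?rmulDl ?rmulDr ?rmulA. Qed.

Definition mult_rng (c : B) : multiplier B := Multiplier (mult_rngP c).

Lemma mult_rngD c d : mult_rng (c + d) = mult_rng c + mult_rng d.
Proof. by apply: mult_eq => b; [apply: rmulDr | apply: rmulDl]. Qed.

Lemma mult_rngM c d : mult_rng (c ** d) = mult_rng c * mult_rng d.
Proof. by apply: mult_eq => b; rewrite (mR_mul, mL_mul) /mR /mL /= rmulA. Qed.

End RngMultipliers.

(** * Restriction of multipliers to the ideal [phi A] *)

Section Restriction.
Variables (G : groupType) (A : comPzRingType) (alpha : unital_partial_action G A).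
Variables (B : rngType) (beta : ring_action G B) (phi : A -> B).
Variable E : enveloping_action alpha beta phi.

Local Notation "1_[ g ]" := (pa_one alpha g) (format "1_[ g ]").
Local Notation M := (mult_ring E).
Local Notation U := (unit_group M).
Local Notation e := (phi 1).

Lemma env_B a b : phi (a - b) = phi a - phi b.
Proof. by apply: (addIr (phi b)); rewrite -(env_D E) !subrK. Qed.

Lemma env_1l a : e ** phi a = phi a.
Proof. by rewrite -(env_M E) mul1r. Qed.

Lemma env_idealM a b : exists c, phi c = phi a ** b.
Proof.
have [_ _ idE] := env_ideal E.
by have [_ [c _ <-]] := idE b (phi a) (imageT phi a); exists c.
Qed.

(** Both sides lie in the image of the domain of [g], and each acts on the other as an identity. *)
Lemma env_one g : phi 1_[g] = e ** beta g e.
Proof.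
have [_ _ idE] := env_ideal E.
have [g1 [_ [c _ <-] cg]] : (range phi `&` (beta g @` range phi))%classic (phi 1_[g]).
  rewrite -(env_dom E); exists 1_[g] => //; apply/pa_domP; exact: pa_one_idem.
have : (range phi `&` (beta g @` range phi))%classic (e ** beta g e).
  split; first by have [c' <-] := env_idealM 1 (beta g e).
  have [c' c'E] := env_idealM 1 (beta g^-1%g e).
  exists (phi c') => //; rewrite c'E ra_actM ra_actKV; exact: (env_rmulC E).
rewrite -(env_dom E) => -[d /pa_domP dg dE].
rewrite -dE -dg (env_M E) dE rmulA -(env_M E) mulr1.
by rewrite -cg -ra_actM -(env_M E) mulr1.
Qed.

(** Moved inside [beta g], the factor [e] becomes its translate by [g^-1], whose product with [e] is
    the image of [1_[g^-1]]; so only the part of [a] in the domain survives. *)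
Lemma env_cut g a : e ** beta g (phi a) = phi (pa_act alpha g (1_[g^-1%g] * a)).
Proof.
rewrite (env_act E); last by apply/pa_domP; rewrite mulrA pa_one_idem.
rewrite (env_M E) env_one !ra_actM ra_actKV (env_rmulC E (beta g e)).
by rewrite -rmulA -ra_actM env_1l.
Qed.

Lemma pa_act_unit g : pa_act alpha g (1_[g^-1%g] * 1) = 1_[g].
Proof. by rewrite -(pa_one1 alpha) pa_act_one mulg1 pa_one_idem. Qed.

Lemma env_local_unit (b : B) : exists c, c ** b = b.
Proof.
have [s ->] := env_sum E b; elim: s => [|p s [c cb]].
  by exists 0; rewrite big_nil rmulr0.
rewrite big_cons; move: (\sum_(_ <- _) _) cb => b2 cb; set b1 := beta _ _.
pose d := beta p.1 e; have db : d ** b1 = b1 by rewrite -ra_actM env_1l.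
(* The usual join of two commuting local units: [d] fixes [b1] and [c] fixes [b2]. *)
exists (c + d - d ** c); rewrite !rmulDl !rmulDr !rmulNr db -(rmulA d c b2) cb.
rewrite (env_rmulC E d c) -(rmulA c d) db addrACA addrK.
by rewrite [X in X + _]addrAC subrr add0r addrC.
Qed.

(** By local units [c] is some [d ** c], and [d] is a sum of elements of translates of [phi A], each
    of which kills [c]. *)
Lemma env_eq0 (c : B) : (forall h, beta h e ** c = 0) -> c = 0.
Proof.
move=> c0; have [d <-] := env_local_unit c; have [s ->] := env_sum E d.
rewrite rmul_suml big1_seq // => p _.
by rewrite -env_1l ra_actM (env_rmulC E (beta _ e)) -rmulA c0 rmulr0.
Qed.

Lemma env_eq (c d : B) : (forall h, beta h e ** c = beta h e ** d) -> c = d.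
Proof.
move=> cd; apply/eqP; rewrite -subr_eq0; apply/eqP/env_eq0 => h.
by rewrite rmulDr rmulrN cd subrr.
Qed.

Lemma mult_eqL (u v : M) : (forall g, mL u (beta g e) = mL v (beta g e)) -> u = v.
Proof.
move=> uv; have eqL b : mL u b = mL v b.
  apply: env_eq => h; rewrite !(env_rmulC E (beta h e)) -!mLM (env_rmulC E b).
  by rewrite !mLM uv.
apply: mult_eq => // b; apply: env_eq => h.
by rewrite !(env_rmulC E (beta h e)) !mRL eqL.
Qed.

Lemma restrictP (u : M) : exists a, phi a = mL u e.
Proof. by rewrite -{1}[1]mulr1 (env_M E) mLM (env_rmulC E); apply: env_idealM. Qed.

(** A multiplier acts on the unital ideal [phi A] as multiplication by a single element, its value
    at [e]. *)
Definition restrict (u : M) : A := sval (cid (restrictP u)).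

Lemma phi_restrict u : phi (restrict u) = mL u e.
Proof. exact: svalP (cid (restrictP u)). Qed.

Lemma restrict_additive : zmod_morphism restrict.
Proof. by move=> u v; apply: (env_inj E); rewrite env_B !phi_restrict. Qed.
Lemma restrict_multiplicative : monoid_morphism restrict.
Proof.
split=> [|u v]; apply: (env_inj E); first by rewrite phi_restrict.
rewrite (env_M E) !phi_restrict -mLM -[e ** _](env_rmulC E) -mLM -(env_M E) mulr1.
by rewrite -mL_mul.
Qed.
HB.instance Definition _ :=
  GRing.isZmodMorphism.Build M A restrict restrict_additive.
HB.instance Definition _ :=
  GRing.isMonoidMorphism.Build M A restrict restrict_multiplicative.

Lemma restrict_conj g (u : M) :
  pa_act alpha g (1_[g^-1%g] * restrict u) = 1_[g] * restrict (mult_conj beta g u : M).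
Proof.
apply: (env_inj E); rewrite -env_cut (env_M E) !phi_restrict mL_conj env_one.
rewrite -rmulA -ra_actM -(env_rmulC E (mL _ _)) -mLM (env_rmulC E _ e).
by rewrite mLM ra_actM ra_actKV (env_rmulC E _ e) rmulA -(env_M E) mulr1.
Qed.

(** * Gluing a family of units of [A] into a unit of the multiplier ring *)

Lemma pa_one_act k a :
  1_[k] * pa_act alpha k (1_[k^-1%g] * a) = pa_act alpha k (1_[k^-1%g] * a).
Proof. by rewrite -pa_act_unit -pa_act_dom mulrACA pa_one_idem mul1r. Qed.

(** By [restrict_conj], these relations hold for the restrictions of the translates of a single
    multiplier. *)
Definition compatible (a : G -> unit_group A) := forall k g,
  pa_act alpha k (1_[k^-1%g] * uval (a g)) = 1_[k] * uval (a (k * g)%g).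

(** Both sides are inverse to [1_[k] * uval (a (k * g))] in the ideal with identity [1_[k]]. *)
Lemma compatible_opp a : compatible a -> compatible (fun g => - a g).
Proof.
move=> compat k g; set x := LHS; set y := RHS.
have xk : 1_[k] * x = x by exact: pa_one_act.
have eq1 : x * (1_[k] * uval (a (k * g)%g)) = 1_[k].
  by rewrite -compat -pa_act_dom mulrACA pa_one_idem [X in _ * X]mulrC uvalN pa_act_unit.
by rewrite -xk -{1}[1_[k]]mulr1 -(uvalN (a (k * g)%g)) mulrC (mulrA 1_[k]) mulrA eq1.
Qed.

Lemma compatible_glue a (b : B) : compatible a ->
  exists c, forall h, beta h e ** c = beta h (phi (uval (a h^-1%g))) ** b.
Proof.
move=> compat; have [s ->] := env_sum E b.
(* The multiplier sought has restriction [a g^-1] after translation by [g^-1], so it must act on the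
   translate of [phi A] by [g] as [beta g (phi (a g^-1))]. By [env_eq] the sum does not depend on
   the decomposition of [b]. *)
exists (\sum_(p <- s) beta p.1 (phi (uval (a p.1^-1%g) * p.2))) => h.
rewrite !rmul_sumr; apply: eq_bigr => -[g d] _ /=.
have cut : beta h e ** beta g (phi (uval (a g^-1%g)))
    = beta h (phi (uval (a h^-1%g))) ** beta g e.
  rewrite -[g](mulVKg h); set k := (h^-1 * g)%g.
  rewrite !(ra_actG beta h k) -!ra_actM env_cut compat invgM mulVKg.
  by rewrite mulrC (env_M E) env_one rmulA -(env_M E) mulr1.
by rewrite (env_M E) ra_actM rmulA cut -rmulA -ra_actM env_1l.
Qed.

(** Additivity and linearity follow from the uniqueness in [env_eq]; as [B] is commutative, one map
    serves as both halves. *)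
Lemma compatible_multiplier a : compatible a ->
  exists u : M, forall b h, beta h e ** mL u b = beta h (phi (uval (a h^-1%g))) ** b.
Proof.
move=> compat; pose m b := sval (cid (compatible_glue b compat)).
have mP b h : beta h e ** m b = beta h (phi (uval (a h^-1%g))) ** b.
  exact: svalP (cid (compatible_glue b compat)) h.
have mD b c : m (b + c) = m b + m c by apply: env_eq => h; rewrite rmulDr !mP rmulDr.
have mM b c : m (b ** c) = m b ** c by apply: env_eq => h; rewrite rmulA !mP rmulA.
have mult_m : `[< is_multiplier (m, m) >].
  apply/asboolP; split=> // b c; first by rewrite (env_rmulC E) mM (env_rmulC E).
  by rewrite -mM (env_rmulC E b (m c)) -mM (env_rmulC E b).
by exists (Multiplier mult_m) => b h; apply: mP.
Qed.

Lemma compatible_unit a : compatible a ->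
  exists u : U, forall g, restrict (mult_conj beta g (uval u) : M) = uval (a g).
Proof.
move=> compat; have [u uP] := compatible_multiplier compat.
have [v vP] := compatible_multiplier (compatible_opp compat).
have uv1 : u * v = 1.
  apply: mult_eqL => g; apply: env_eq => h; rewrite mL_mul uP.
  rewrite -[uval (a _)]mulr1 (env_M E) ra_actM -rmulA vP.
  by rewrite rmulA -ra_actM -(env_M E) uvalN.
have [w wu] : exists w : U, uval w = u by apply: unit_groupP; exists v.
exists w => g; apply: (env_inj E); rewrite wu phi_restrict mL_conj.
apply: (can_inj (ra_actK beta g^-1%g)); rewrite ra_actK; set h := (g^-1)%g.
rewrite -[in LHS](mulr1 1) (env_M E) ra_actM mLM (env_rmulC E) uP.
by rewrite -ra_actM -(env_M E) mulr1 invgK.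
Qed.

Lemma restrict_conj_inj (u v : M) :
  (forall g, restrict (mult_conj beta g u : M) = restrict (mult_conj beta g v : M)) ->
  u = v.
Proof.
move=> uv; apply: mult_eqL => g; apply: (can_inj (ra_actK beta g^-1%g)).
have /(congr1 phi) := uv g^-1%g.
by rewrite !phi_restrict !mL_conj invgK.
Qed.

Definition mult_phi (a : A) : M := mult_rng (phi a).

Lemma mult_phiD a b : mult_phi (a + b) = mult_phi a + mult_phi b.
Proof. by rewrite /mult_phi (env_D E); apply: mult_rngD. Qed.

Lemma mult_phiM a b : mult_phi (a * b) = mult_phi a * mult_phi b.
Proof. by rewrite /mult_phi (env_M E); apply: mult_rngM. Qed.

Lemma restrict_mult_phi a : restrict (mult_phi a) = a.
Proof.
apply: (env_inj E); rewrite phi_restrict.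
by rewrite -[mL _ _]/(phi a ** e) -(env_M E) mulr1.
Qed.

(* [phi A] being a unital ideal of [B], a unit of [A] extends by [1] on its
   complement. *)
Lemma unit_lift (a : unit_group A) : exists u : U, restrict (uval u) = uval a.
Proof.
pose m (c : A) := 1 + mult_phi (c - 1).
have mM c d : m c * m d = m (c * d).
  rewrite /m mulrDl mul1r mulrDr mulr1 -mult_phiM -addrA -!mult_phiD.
  congr (1 + mult_phi _); rewrite -{1}[c - 1]mulr1 -mulrDr [1 + _]addrC subrK.
  by rewrite mulrBl mul1r addrC addrA subrK.
have m1 : m 1 = 1.
  by rewrite /m subrr; apply: (addIr (mult_phi 0)); rewrite -addrA -mult_phiD addr0.
have [u uE] : exists u : U, uval u = m (uval a).
  by apply: unit_groupP; exists (m (uval (- a))); rewrite mM uvalN m1.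
by exists u; rewrite uE /m rmorphD rmorph1 /= restrict_mult_phi addrC subrK.
Qed.

Definition restrict_unit : U -> unit_group A := unit_map restrict.
HB.instance Definition _ := GRing.Additive.on restrict_unit.

(** * The restriction chain map from global to partial cochains *)

Lemma restrict_cochainP n (f : n.-tuple G -> U) :
  `[< forall x, invertible_in (pa_one_tuple alpha x)
                  (pa_one_tuple alpha x * uval (restrict_unit (f x))) >].
Proof.
apply/asboolP => x; split; first by rewrite mulrA pa_one_tuple_idem.
exists (pa_one_tuple alpha x * uval (- restrict_unit (f x))).
by rewrite mulrA mulrACA pa_one_tuple_idem uvalN mulr1.
Qed.

Definition restrict_cochain n (f : n.-tuple G -> U) : pcochain alpha n :=
  PCochain (restrict_cochainP f).

Lemma restrict_cochainE n (f : n.-tuple G -> U) x :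
  restrict_cochain f x = pa_one_tuple alpha x * uval (restrict_unit (f x)).
Proof. by []. Qed.

Lemma restrict_cochain_additive n : zmod_morphism (@restrict_cochain n).
Proof.
move=> f g; apply: (addIr (restrict_cochain g)); rewrite subrK.
apply/val_inj/funext => x.
change (pa_one_tuple alpha x * uval (restrict_unit (f x - g x))
  * (pa_one_tuple alpha x * uval (restrict_unit (g x)))
  = pa_one_tuple alpha x * uval (restrict_unit (f x))).
by rewrite mulrACA pa_one_tuple_idem -uvalD -raddfD subrK.
Qed.
HB.instance Definition _ n :=
  GRing.isZmodMorphism.Build _ _ (@restrict_cochain n) (@restrict_cochain_additive n).

Lemma restrict_cochain_surj n (F : pcochain alpha n) :
  exists f : n.-tuple G -> U, restrict_cochain f = F.
Proof.
have lifts x : exists u : U, pa_one_tuple alpha x * restrict (uval u) = F x.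
  have [eF [F' [eF' FF']]] := pcochainP F x.
  set ex := pa_one_tuple alpha x in eF eF' FF' *.
  have ex_ex : ex * ex = ex by exact: pa_one_tuple_idem.
  have exC y : ex * y = y -> (1 - ex) * y = 0.
    by move=> exy; rewrite mulrBl mul1r exy subrr.
  (* A unit of the ideal with identity [ex] becomes a unit of [A] when extended by [1] on the
     complement. *)
  have [a aE] : exists a : unit_group A, uval a = F x + (1 - ex).
    apply: unit_groupP; exists (F' + (1 - ex)).
    rewrite mulrDl (mulrDr (F x)) (mulrDr (1 - ex)) FF' [F x * _]mulrC.
    rewrite (exC _ eF) (exC _ eF') addr0 add0r.
    by rewrite mulrBr mulr1 [X in _ - X]mulrC mulrBr mulr1 ex_ex subrr subr0 addrC subrK.
  have [u uE] := unit_lift a; exists u.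
  by rewrite uE aE mulrDr eF [ex * _]mulrC exC // addr0.
have [f fE] := choice lifts; exists f.
by apply/val_inj/funext => x; apply: fE.
Qed.

Lemma restrict_cochain_sgn n (f : n.-tuple G -> U) k x :
  pcochain_sgn (restrict_cochain f) k x =
  pa_one_tuple alpha x * uval (restrict_unit (f x *~ (-1) ^+ k)).
Proof.
rewrite /pcochain_sgn -signr_odd; case: (odd k); rewrite ?expr1 ?expr0 ?mulr1z //.
rewrite mulrNz mulr1z; apply: inv_in_eq.
  by rewrite mulrA pa_one_tuple_idem.
by rewrite restrict_cochainE (raddfN restrict_unit) mulrACA pa_one_tuple_idem uvalN mulr1.
Qed.

(** The first factor is handled by [restrict_conj]. In the others, the idempotents of the faces are
    absorbed by that of [x]. *)
Lemma restrict_cochain_cobd n (f : n.-tuple G -> U) :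
  restrict_cochain (@group_cobd G (unit_mult_gmodule E) n f) = pcobd (restrict_cochain f).
Proof.
apply/val_inj/funext => x.
change (pa_one_tuple alpha x
  * uval (restrict_unit (@group_cobd G (unit_mult_gmodule E) n f x))
  = pcobd_fun (restrict_cochain f) x).
rewrite /pcobd_fun restrict_cochain_sgn; under eq_bigr do rewrite restrict_cochain_sgn.
set g := tnth x ord0; set ex := pa_one_tuple alpha x.
have -> : pa_act alpha g (1_[g^-1%g] * restrict_cochain f (face_first x))
    = ex * restrict (mult_conj beta g (uval (f (face_first x)))).
  rewrite -{1}[1_[_]]pa_one_idem /= mulrACA pa_act_dom restrict_conj.
  rewrite pa_one_tuple_face_first mulrA -/ex; congr (_ * _).
  rewrite /ex -pa_one_tuple_face_first -(pa_act_unit g) -pa_act_dom mulrACA.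
  by rewrite pa_one_idem mulr1.
have absorb (e' p y : A) : ex * e' = ex -> ex * p = p -> p * (e' * y) = p * y.
  by move=> exe <-; rewrite mulrACA exe mulrA.
have ex_ex : ex * ex = ex by exact: pa_one_tuple_idem.
set r := restrict _; set pr := \prod_(_ < _) _.
have prE : ex * pr =
    ex * uval (restrict_unit (\sum_(i < n) f (face_mul i x) *~ (-1) ^+ i.+1)).
  rewrite /pr (raddf_sum restrict_unit); elim/big_rec2: _ => // i p q _ pq.
  by rewrite uvalD mulrA absorb ?pa_one_tuple_face_mul // mulrAC pq mulrAC mulrA.
have -> : ex * r * pr = ex * pr * r by rewrite mulrAC.
rewrite absorb ?pa_one_tuple_face_last ?mulrA ?ex_ex // prE.
rewrite (mulrAC ex).
rewrite -!mulrA; congr (_ * _).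
by rewrite [group_cobd _ _]/group_cobd !(raddfD restrict_unit) !uvalD -mulrA.
Qed.

(** * Global cochains as invariant functions with values in the units of [A] *)

Section Homogeneous.
Variable n : nat.
Implicit Types f : n.-tuple G -> unit_mult_gmodule E.

Definition restrict_hom f (s : seq G) : unit_group A := restrict_unit (homogeneous f s).

Lemma restrict_homB f f' s :
  restrict_hom (f - f') s = restrict_hom f s - restrict_hom f' s.
Proof. by rewrite /restrict_hom homogeneousB (raddfB restrict_unit). Qed.

Lemma restrict_hom0 s : restrict_hom 0 s = 0.
Proof.
by rewrite -(subrr (0 : n.-tuple G -> unit_mult_gmodule E)) restrict_homB subrr.
Qed.

Lemma restrict_homN f s : restrict_hom (- f) s = - restrict_hom f s.
Proof. by rewrite -(add0r (- f)) restrict_homB restrict_hom0 sub0r. Qed.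

Lemma restrict_hom_shift f k s : (0 < size s)%N ->
  pa_act alpha k (1_[k^-1%g] * uval (restrict_hom f s))
  = 1_[k] * uval (restrict_hom f (map ( *%g k) s)).
Proof. by move=> s0; rewrite restrict_conj /restrict_hom homogeneousM. Qed.

Lemma restrict_hom_inj f f' :
  (forall s, size s = n.+1 -> restrict_hom f s = restrict_hom f' s) -> f =1 f'.
Proof.
move=> ff' x; apply: uval_inj; apply: restrict_conj_inj => g.
have size_gx : size (g :: scanl *%g g x) = n.+1 by rewrite /= size_scanl size_tuple.
have := congr1 (@uval _) (ff' _ size_gx).
by rewrite /restrict_hom !homogeneous_scanl.
Qed.

(** For fixed inhomogeneous coordinates [x], invariance says that the values of [Psi] over all base
    points [g] form a compatible family; the unit that it glues to is [f x]. *)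
Lemma restrict_hom_surj (Psi : seq G -> unit_group A) :
    (forall k s, size s = n.+1 -> pa_act alpha k (1_[k^-1%g] * uval (Psi s))
       = 1_[k] * uval (Psi (map ( *%g k) s))) ->
  exists f, forall s, size s = n.+1 -> restrict_hom f s = Psi s.
Proof.
move=> shift; pose fam (x : n.-tuple G) g := Psi (g :: scanl *%g g x).
have compat x : compatible (fam x).
  move=> k g; rewrite /fam shift /= ?size_scanl ?size_tuple //.
  by rewrite map_scanl_mul.
have [f fP] := choice (fun x => compatible_unit (compat x)).
exists f => -[|g s] //= [size_s].
have size_x : size (quotients g s) == n by rewrite size_quotients size_s.
rewrite -(quotientsK g s) -[quotients g s]/(val (Tuple size_x)); apply: uval_inj.
by rewrite /restrict_hom homogeneous_scanl [LHS]fP.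
Qed.
End Homogeneous.

Lemma list_cobd_restrict_hom n (f : n.-tuple G -> unit_mult_gmodule E) s :
    size s = n.+2 ->
  list_cobd (restrict_hom f) s = restrict_hom (group_cobd f) s.
Proof.
move=> size_s; rewrite /restrict_hom -list_cobd_homogeneous // (raddf_sum restrict_unit).
by apply: eq_bigr => i _; rewrite (raddfMz restrict_unit).
Qed.

End Restriction.

(** * Products of indecomposable rings *)

Section ProductRing.
Variables (Lambda : Type) (Al : Lambda -> comPzRingType).
Local Notation A := (prod_ring Al).

Definition coord l (a : A) : Al l := a l.

Lemma coord_additive l : zmod_morphism (coord l).
Proof. by []. Qed.
Lemma coord_multiplicative l : monoid_morphism (coord l).
Proof. by []. Qed.
HB.instance Definition _ l :=
  GRing.isZmodMorphism.Build A (Al l) (coord l) (coord_additive l).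
HB.instance Definition _ l :=
  GRing.isMonoidMorphism.Build A (Al l) (coord l) (coord_multiplicative l).

Lemma prod_ringP (a b : A) : (forall l, a l = b l) -> a = b.
Proof. by move=> ab; apply: functional_extensionality_dep. Qed.

Lemma unit_prod_ringP (u v : unit_group A) :
  (forall l, unit_map (coord l) u = unit_map (coord l) v) -> u = v.
Proof.
by move=> uv; apply/uval_inj/prod_ringP => l; have /(congr1 (@uval _)) := uv l.
Qed.

Lemma unit_prod_ring_glue (u : Lambda -> unit_group A) :
  exists v : unit_group A, forall l, unit_map (coord l) v = unit_map (coord l) (u l).
Proof.
have [v vE] : exists v : unit_group A, uval v = fun l => uval (u l) l.
  apply: unit_groupP; exists (fun l => uval (- u l) l); apply: prod_ringP => l.
  by have /(congr1 (coord l)) := uvalN (u l).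
by exists v => l; apply: uval_inj; rewrite /= /coord vE.
Qed.

Definition point l : A := fun k => if pselect (k = l) then 1 else 0.

Lemma point_diag l : point l l = 1.
Proof. by rewrite /point; case: pselect. Qed.

Lemma point_mul l (a b : A) : a l = b l -> point l * a = point l * b.
Proof.
move=> ab; apply: prod_ringP => k; rewrite -![(point l * _) k]/(point l k * _ k) /point.
by case: pselect => [kl|_] /=; rewrite ?mul0r // kl ab.
Qed.

Hypothesis indecomp : forall l, indecomposable (Al l).

Lemma coord1_neq0 l : (1 : Al l) != 0.
Proof. by case: (indecomp l). Qed.

Lemma coord_idem (a : A) l : a * a = a -> a l != 0 -> a l = 1.
Proof.
move=> /(congr1 (coord l)) aa /eqP a0; have [_ idem] := indecomp l.
by have [] := idem (a l) aa (mulrC (a l)).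
Qed.

Lemma idem_neq0 (a : A) : a * a = a -> a != 0 -> exists l, a l = 1.
Proof.
move=> aa /eqP a0; apply: contrapT => a1; apply: a0; apply: prod_ringP => l.
apply/eqP; apply: contrapT => /negP /(coord_idem aa) al; apply: a1; by exists l.
Qed.

(** * How the partial action permutes the factors *)

Variables (G : groupType) (alpha : unital_partial_action G A).
Local Notation "1_[ g ]" := (pa_one alpha g) (format "1_[ g ]").

Lemma pa_one_coord g l : 1_[g] l != 0 -> 1_[g] l = 1.
Proof. exact: coord_idem (pa_one_idem alpha g). Qed.

Lemma pa_act0 k : pa_act alpha k 0 = 0.
Proof.
have [_ actD _] := pa_iso alpha k.
have d0 : pa_dom alpha k^-1%g 0 by apply/pa_domP; rewrite mulr0.
by apply: (addrI (pa_act alpha k 0)); rewrite -actD // !addr0.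
Qed.

(* [m] is the point that [k] moves to [l]: as the rings [Al l] are
   indecomposable, an isomorphism between ideals of [A] permutes the factors. *)
Lemma pa_act_point k l : 1_[k] l != 0 -> exists m, forall a b : A, a m = b m ->
  pa_act alpha k (1_[k^-1%g] * a) l = pa_act alpha k (1_[k^-1%g] * b) l.
Proof.
move=> /pa_one_coord kl; have [[_ inj_act surj_act] _ actM] := pa_iso alpha k.
have dom_mul a b : pa_dom alpha k^-1%g a -> pa_dom alpha k^-1%g (a * b).
  by move=> /pa_domP aE; apply/pa_domP; rewrite mulrA aE.
have act_inj a b : pa_dom alpha k^-1%g a -> pa_dom alpha k^-1%g b ->
    pa_act alpha k a = pa_act alpha k b -> a = b.
  by move=> da db; apply: inj_act; rewrite inE.
have [i di act_i] : exists2 i, pa_dom alpha k^-1%g i & pa_act alpha k i = point l.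
  have /surj_act[i di act_i] : pa_dom alpha k (point l).
    by apply/pa_domP; rewrite mulrC -[RHS]mulr1; apply: point_mul.
  by exists i.
have point_idem l' : point l' * point l' = point l'.
  by rewrite -[RHS]mulr1; apply: point_mul; rewrite point_diag.
have ii : i * i = i.
  by apply: act_inj; rewrite ?actM ?act_i ?point_idem //; apply: dom_mul.
have point_neq0 l' : point l' != 0.
  apply/eqP => /(congr1 (coord l')); rewrite /coord point_diag => /eqP.
  by apply/negP; exact: coord1_neq0.
have [m im] : exists m, i m = 1.
  apply: idem_neq0 => //; apply: contra_neq (point_neq0 l) => i0.
  by rewrite -act_i i0 pa_act0.
have qi : i * point m = point m.
  by rewrite mulrC -[RHS]mulr1; apply: point_mul.
have dq : pa_dom alpha k^-1%g (point m) by rewrite -qi; apply: dom_mul.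
(* As [point m] lies below [i], its image [q] is a nonzero idempotent below [point l], hence equal
   to [1] at [l]. *)
pose q := pa_act alpha k (point m); have ql : point l * q = q.
  by rewrite -act_i -actM // qi.
have qq : q * q = q by rewrite -actM // point_idem.
have q1 : q l = 1.
  apply: coord_idem => //; apply: contra_neq (point_neq0 m) => q0.
  apply: act_inj; rewrite ?pa_act0 //; first by apply/pa_domP; rewrite mulr0.
  by rewrite -/q -ql (point_mul (b := (0 : A)) q0) mulr0.
exists m => a b ab.
(* Multiplying by [q] does not change the coordinate at [l], and [point m] erases all coordinates
   but [m]. *)
have cut c : pa_act alpha k (1_[k^-1%g] * c) l
    = pa_act alpha k (point m * (1_[k^-1%g] * c)) l.
  rewrite (actM (point m)) //; last by apply/pa_domP; rewrite mulrA pa_one_idem.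
  by rewrite -[RHS]/(q l * _ l) q1 mul1r.
rewrite !cut (@point_mul _ _ (1_[k^-1%g] * b)) //.
by rewrite -[LHS]/(_ m * a m) ab.
Qed.

(** Left translation by [k] carries the set of [h] with [1_[h]] nonzero at [m] onto the
    corresponding set at [l]. *)
Lemma pa_one_point k l m : 1_[k] l != 0 -> (forall a b : A, a m = b m ->
    pa_act alpha k (1_[k^-1%g] * a) l = pa_act alpha k (1_[k^-1%g] * b) l) ->
  forall h, (1_[(k * h)%g] l != 0) = (1_[h] m != 0).
Proof.
move=> /pa_one_coord kl loc h.
have -> : 1_[(k * h)%g] l = pa_act alpha k (1_[k^-1%g] * 1_[h]) l.
  by rewrite pa_act_one -[RHS]/(_ l * _ l) kl mul1r.
have [h0|/pa_one_coord h1] := eqVneq (1_[h] m) 0.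
  by rewrite (loc _ (0 : A)) // mulr0 pa_act0 !eqxx.
by rewrite (loc _ (1 : A) h1) pa_act_unit kl coord1_neq0.
Qed.

(** * The retractions and the contraction that they define *)

Definition inside l (s : seq G) := all (fun g => 1_[g] l != 0) s.

(* The choice depends only on the set of candidates, which makes it equivariant. *)
Definition retract l (g : G) : G :=
  (g * if 1_[g] l != 0 then 1 else xget 1 [set t | 1_[(g * t)%g] l != 0])%g.

Lemma retract_in l g : 1_[retract l g] l != 0.
Proof.
rewrite /retract; case: ifP => [|_]; first by rewrite mulg1.
(* The candidate [g^-1] shows that the choice is not void, since [1_[1] = 1]. *)
apply: (@xgetI _ 1%g [set t | 1_[(g * t)%g] l != 0] g^-1%g) => /=.
by rewrite mulgV pa_one1 coord1_neq0.
Qed.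

Lemma retract_id l g : 1_[g] l != 0 -> retract l g = g.
Proof. by rewrite /retract => ->; rewrite mulg1. Qed.

Lemma retractM k l m : (forall h, (1_[(k * h)%g] l != 0) = (1_[h] m != 0)) ->
  forall g, retract l (k * g)%g = (k * retract m g)%g.
Proof.
move=> km g; have -> : retract l (k * g)%g =
    (k * g * if 1_[g] m != 0 then 1 else xget 1 [set t | 1_[(k * g * t)%g] l != 0])%g.
  by rewrite /retract km.
rewrite (_ : [set t | _] = [set t | 1_[(g * t)%g] m != 0])%classic ?mulgA //.
by apply/seteqP; split=> t /=; rewrite -mulgA km.
Qed.

Lemma inside_retract l s : inside l (map (retract l) s).
Proof. by rewrite /inside all_map; apply/allP => g _; exact: retract_in. Qed.

Lemma contract_subproof (Phi : seq G -> unit_group A) s :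
  exists v : unit_group A, forall l,
    unit_map (coord l) v = unit_map (coord l) (prism (retract l) Phi s).
Proof. exact: unit_prod_ring_glue. Qed.

Definition contract Phi s := sval (cid (contract_subproof Phi s)).

Lemma contractE Phi s l :
  unit_map (coord l) (contract Phi s) = unit_map (coord l) (prism (retract l) Phi s).
Proof. exact: svalP (cid (contract_subproof Phi s)) l. Qed.

(** The retraction fixes the entries of [s], so each prism term evaluates [Phi] at [s] with one
    entry repeated, still inside at [l]. *)
Lemma contract_inside n (Phi : seq G -> unit_group A) l :
    (forall s, size s = n.+1 -> inside l s -> unit_map (coord l) (Phi s) = 0) ->
  forall s, size s = n -> inside l s -> unit_map (coord l) (contract Phi s) = 0.
Proof.
move=> Phi0 s size_s ins; rewrite contractE /prism (raddf_sum (unit_map (coord l))).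
rewrite big1 // => i _; rewrite (raddfMz (unit_map (coord l))).
rewrite /= Phi0 ?mul0rz // ?size_prism ?size_s //.
have mapE : map (retract l) (drop i s) = drop i s.
  rewrite -[RHS]map_id; apply/eq_in_map => g /mem_drop gs.
  by apply: retract_id; exact: (allP ins).
rewrite mapE /inside all_cat; apply/andP; split; apply/allP => g.
  by move/mem_take; exact: (allP ins).
by move/mem_drop; exact: (allP ins).
Qed.

Lemma contract_shift n (Phi : seq G -> unit_group A) :
    (forall k s, size s = n.+1 -> pa_act alpha k (1_[k^-1%g] * uval (Phi s))
       = 1_[k] * uval (Phi (map ( *%g k) s))) ->
  forall k s, size s = n -> pa_act alpha k (1_[k^-1%g] * uval (contract Phi s))
    = 1_[k] * uval (contract Phi (map ( *%g k) s)).
Proof.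
move=> shift k s size_s; apply: prod_ringP => l.
rewrite -[RHS]/(1_[k] l * _ l); have [kl|kl] := eqVneq (1_[k] l) 0.
  by rewrite -pa_one_act -[LHS]/(1_[k] l * _ l) kl !mul0r.
have [m loc] := pa_act_point kl; have km := pa_one_point kl loc.
have tau_zmod : zmod_morphism (fun a : A => pa_act alpha k (1_[k^-1%g] * a) l).
  have [_ actD _] := pa_iso alpha k.
  have tauD (a b : A) : pa_act alpha k (1_[k^-1%g] * (a + b)) l =
    pa_act alpha k (1_[k^-1%g] * a) l + pa_act alpha k (1_[k^-1%g] * b) l.
    by rewrite mulrDr actD //; apply/pa_domP; rewrite mulrA pa_one_idem.
  by move=> a b; apply: (addIr (pa_act alpha k (1_[k^-1%g] * b) l)); rewrite -tauD !subrK.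
have tau_mon : monoid_morphism (fun a : A => pa_act alpha k (1_[k^-1%g] * a) l).
  split=> [|a b]; first by rewrite pa_act_unit (pa_one_coord kl).
  by rewrite -[RHS]/((_ * _ : A) l) -pa_act_dom mulrACA pa_one_idem.
(* The coordinate at [l] of the action of [k]: a ring morphism factoring through the coordinate [m].
   By [retractM] it takes the prism of [retract m] to that of [retract l], term by term. *)
pose tau : {rmorphism A -> Al l} :=
  HB.pack (fun a : A => pa_act alpha k (1_[k^-1%g] * a) l)
    (GRing.isZmodMorphism.Build _ _ _ tau_zmod)
    (GRing.isMonoidMorphism.Build _ _ _ tau_mon).
have mE : uval (contract Phi s) m = uval (prism (retract m) Phi s) m.
  by have /(congr1 (@uval _)) := contractE Phi s m.
rewrite (loc _ _ mE) (pa_one_coord kl) mul1r.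
have -> : uval (contract Phi (map ( *%g k) s)) l
    = uval (prism (retract l) Phi (map ( *%g k) s)) l.
  by have /(congr1 (@uval _)) := contractE Phi (map ( *%g k) s) l.
suff : unit_map tau (prism (retract m) Phi s)
     = unit_map (coord l) (prism (retract l) Phi (map ( *%g k) s)).
  by move=> /(congr1 (@uval _)).
rewrite /prism size_map (raddf_sum (unit_map tau)) (raddf_sum (unit_map (coord l))).
apply: eq_bigr => i _; rewrite (raddfMz (unit_map tau)) (raddfMz (unit_map (coord l))).
congr (_ *~ _); apply: uval_inj.
rewrite [LHS](congr1 (fun a : A => a l) (shift _ _ _)) ?size_prism ?size_s //.
rewrite -[LHS]/(1_[k] l * _ l) (pa_one_coord kl) mul1r.
rewrite map_cat -map_take -map_drop -!map_comp.
by rewrite [in RHS](eq_map (retractM km)).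
Qed.

(** The scan lists the vertices of the homogeneous tuple based at [1], without the vertex [1], whose
    idempotent is trivial. *)
Lemma pa_one_tupleE n (x : n.-tuple G) :
  pa_one_tuple alpha x = \prod_(g <- scanl *%g 1%g x) 1_[g].
Proof.
have foldlM g (t : seq G) : foldl *%g g t = (g * \prod_(y <- t) y)%g.
  by elim: t g => [|h t IH] g; rewrite ?big_nil ?mulg1 //= IH big_cons mulgA.
rewrite (big_nth 1%g) size_scanl size_tuple big_mkord; apply: eq_bigr => k _.
by rewrite nth_scanl ?size_tuple // foldlM mul1g.
Qed.

Lemma prod_pa_one s l :
  (\prod_(g <- s) 1_[g]) l = if inside l s then 1 else 0.
Proof.
elim: s => [|g s IH]; first by rewrite big_nil.
rewrite big_cons -[LHS]/(1_[g] l * _ l) IH /=.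
have [->|/pa_one_coord ->] := eqVneq (1_[g] l) 0; first by rewrite mul0r.
by rewrite mul1r.
Qed.

(** * Exactness of the kernel of restriction *)

Variables (B : rngType) (beta : ring_action G B) (phi : A -> B).
Variable E : enveloping_action alpha beta phi.

(** Partial cochains only see tuples based at [1]. A tuple based at [g] and inside at [l] is the
    translate of such a tuple [t], and its value at [l] is read off from the value at [t] in the
    factor [m] that [g] moves to [l]. *)
Lemma restrict_cochain_eq0 n (f : n.-tuple G -> unit_mult_gmodule E) :
  (forall s l, size s = n.+1 -> inside l s -> unit_map (coord l) (restrict_hom f s) = 0)
  <-> restrict_cochain f = 0.
Proof.
have hom1 (x : n.-tuple G) :
    restrict_hom f (1%g :: scanl *%g 1%g x) = restrict_unit (f x).
  by rewrite /restrict_hom homogeneous_scanl gm_act1.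
split=> [f0|f0 s l].
  apply/val_inj/funext => x; apply: prod_ringP => l.
  rewrite -[RHS]/(pa_one_tuple alpha x l) -[LHS]/(pa_one_tuple alpha x l * _ l).
  rewrite pa_one_tupleE prod_pa_one; case: ifP => ins; last by rewrite mul0r.
  rewrite mul1r -hom1.
  have := f0 (1%g :: scanl *%g 1%g x) l.
  rewrite /= pa_one1 coord1_neq0 size_scanl size_tuple => /(_ erefl ins).
  by move=> /(congr1 (@uval _)).
case: s => // g s [size_s] /= /andP[gl sl].
have [m loc] := pa_act_point gl; have km := pa_one_point gl loc.
have size_x : size (quotients g s) == n by rewrite size_quotients size_s.
pose x := Tuple size_x; pose t := (1 :: scanl *%g 1 x)%g.
have sE : g :: s = map ( *%g g) t.
  by rewrite /= map_scanl_mul mulg1 quotientsK.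
have homE : pa_act alpha g (1_[g^-1%g] * uval (restrict_hom f t)) l
    = uval (restrict_hom f (g :: s)) l.
  by rewrite restrict_hom_shift // -sE -[RHS]mul1r -(pa_one_coord gl).
apply: uval_inj.
rewrite -[LHS]/(uval (restrict_hom f (g :: s)) l) -[RHS]/(1 : Al l) -homE.
rewrite (loc _ (1 : A)) ?pa_act_unit ?(pa_one_coord gl) // /t hom1.
have ins : inside m (scanl *%g 1%g x).
  move: sl; rewrite -[s](quotientsK g) -[quotients g s]/(val x) -{1}[g]mulg1.
  by rewrite -map_scanl_mul /inside all_map; apply: sub_all => h /=; rewrite km.
have /(congr1 (fun c : pcochain alpha n => c x m)) := f0.
rewrite -[LHS]/(pa_one_tuple alpha x m * _ m) -[RHS]/(pa_one_tuple alpha x m).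
by rewrite pa_one_tupleE prod_pa_one ins mul1r.
Qed.

Lemma restrict_kernel_exact0 (f : 0.-tuple G -> unit_mult_gmodule E) :
  restrict_cochain f = 0 -> group_cobd f = 0 -> f = 0.
Proof.
move=> /restrict_cochain_eq0 f0 df0; apply/funext; apply: (restrict_hom_inj (f' := 0)).
case=> [|g [|? ?]] // _; apply: unit_prod_ringP => l.
(* The cocycle condition on this edge makes the function constant, equal to its value at [1], which
   is inside at every [l]. *)
have : list_cobd (restrict_hom f) [:: g; 1%g] = 0.
  by rewrite list_cobd_restrict_hom // df0 restrict_hom0.
rewrite !list_cobd_cons list_cobd_nil subr0 => /eqP; rewrite subr_eq0 => /eqP <-.
by rewrite restrict_hom0 raddf0 f0 //= pa_one1 coord1_neq0.
Qed.

Lemma restrict_kernel_exactS n (f : n.+1.-tuple G -> unit_mult_gmodule E) :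
    restrict_cochain f = 0 -> group_cobd f = 0 ->
  exists2 h : n.-tuple G -> unit_mult_gmodule E,
    restrict_cochain h = 0 & group_cobd h = f.
Proof.
move=> /restrict_cochain_eq0 f0 df0; pose Phi := restrict_hom f.
have shift k s : size s = n.+2 -> pa_act alpha k (1_[k^-1%g] * uval (Phi s))
    = 1_[k] * uval (Phi (map ( *%g k) s)).
  by move=> size_s; apply: restrict_hom_shift; rewrite size_s.
have [h hE] := restrict_hom_surj E (contract_shift shift).
(* The homotopy yields the retracted value minus [Phi s], hence the sign. *)
exists (- h).
  rewrite raddfN; apply/eqP; rewrite oppr_eq0.
  apply/eqP/restrict_cochain_eq0 => s l size_s ins.
  by rewrite hE //; apply: (contract_inside _ size_s ins) => t; apply: f0.
apply/funext; apply: restrict_hom_inj => s size_s.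
rewrite -list_cobd_restrict_hom //; apply: unit_prod_ringP => l.
have -> : list_cobd (restrict_hom (- h)) s = - list_cobd (contract Phi) s.
  rewrite /list_cobd -sumrN; apply: eq_bigr => i _.
  by rewrite restrict_homN hE ?size_rem_nth ?size_s // mulNrz.
have -> : unit_map (coord l) (- list_cobd (contract Phi) s)
    = - unit_map (coord l) (list_cobd (prism (retract l) Phi) s).
  rewrite (raddfN (unit_map (coord l))) /list_cobd !(raddf_sum (unit_map (coord l))).
  congr (- _); apply: eq_bigr => i _.
  by rewrite !(raddfMz (unit_map (coord l))) /= contractE.
have := prism_homotopy (retract l) Phi s.
(* The second prism vanishes because [Phi] is a cocycle, and [Phi] at the retracted list because
   that list is inside at [l]. *)
rewrite [X in _ + X]prism0 ?addr0 => [->|t size_t]; last first.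
  by rewrite list_cobd_restrict_hom ?df0 ?restrict_hom0 // size_t size_s.
have Phi0 : unit_map (coord l) (Phi (map (retract l) s)) = 0.
  by apply: f0; [rewrite size_map | apply: inside_retract].
by rewrite (raddfB (unit_map (coord l))) opprB /= Phi0 subr0.
Qed.

End ProductRing.

Theorem corollary5p4 (G : groupType) (Lambda : Type)
    (Al : Lambda -> comPzRingType)
    (indecomp : forall l, indecomposable (Al l))
    (alpha : unital_partial_action G (prod_ring Al))
    (B : rngType) (beta : ring_action G B) (phi : prod_ring Al -> B)
    (E : enveloping_action alpha beta phi) (n : nat) :
  isomorphic (cohomology (partial_complex alpha) n)
             (cohomology (group_complex (unit_mult_gmodule E)) n).
Proof.
pose r m : {additive cochain (group_complex (unit_mult_gmodule E)) m
    -> cochain (partial_complex alpha) m} := restrict_cochain (E := E) (n := m).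
apply: (@isomorphic_cohomology _ _ r).
- by move=> m f; apply: restrict_cochain_cobd.
- by move=> m f; apply/funext; apply: group_cobd_cobd.
- by move=> m f; apply: restrict_cochain_surj.
- by move=> f; apply: restrict_kernel_exact0.
- by move=> m f; apply: restrict_kernel_exactS.
Qed.
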